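(* Let $\{\mathcal H,\Gamma\}$ be a B-generalized boundary pair for $A^*$ with Weyl family $M(\cdot)$. Let $\mathcal H_s=\overline{\operatorname{ran}}\operatorname{Im}M(\lambda)$ (this does not depend on $\lambda\in\mathbb C\setminus\mathbb R$). Then there exist an ordinary boundary triple $\{\mathcal H_s,\Gamma^0_0,\Gamma^0_1\}$ for $A^*$ and operators $E=E^*\in\mathcal B(\mathcal H)$ and $G\in\mathcal B(\mathcal H,\mathcal H_s)$ with $\ker G=\mathcal H\ominus\mathcal H_s$ such that $\Gamma=\{\{\hat f,\{h,Eh+G^*\Gamma^0_1\hat f\}\}:\ \hat f\in A^*,\ h\in\mathcal H,\ Gh=\Gamma^0_0\hat f\}$, i.e. $\Gamma_0=G^{-1}\Gamma^0_0$ and $\Gamma_1=EG^{-1}\Gamma^0_0+G^*\Gamma^0_1$ (with $G^{-1}$ the inverse of $G$ as a linear relation). If $M_0(\cdot)$ is the Weyl function of $\{\mathcal H_s,\Gamma^0_0,\Gamma^0_1\}$, then $M(\lambda)=G^*M_0(\lambda)G+E$, $\lambda\in\mathbb C\setminus\mathbb R$.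
   Context: $A$ is a closed symmetric relation in a Hilbert space $\mathfrak H$; $\mathcal H$ a Hilbert space. For a linear relation $\Gamma:\mathfrak H^2\to\mathcal H^2$ put $\Gamma_0=\{\{\hat f,h\}:\{\hat f,\{h,h'\}\}\in\Gamma\}$, $\Gamma_1=\{\{\hat f,h'\}:\{\hat f,\{h,h'\}\}\in\Gamma\}$. A B-generalized boundary pair for $A^*$ is a linear relation $\Gamma$ with $\operatorname{dom}\Gamma\subset A^*$ dense in $A^*$, satisfying Green's identity $(f',g)-(f,g')=(h',k)-(h,k')$ for all $\{\{f,f'\},\{h,h'\}\},\{\{g,g'\},\{k,k'\}\}\in\Gamma$, with $\operatorname{ran}\Gamma_0=\mathcal H$ and $\ker\Gamma_0$ selfadjoint; its Weyl family $M(\lambda)=\{\hat h:\{\{f,\lambda f\},\hat h\}\in\Gamma\}$ is then a bounded operator function. An ordinary boundary triple $\{\mathcal K,\Gamma_0,\Gamma_1\}$ for $A^*$ consists of linear maps $\Gamma_0,\Gamma_1:A^*\to\mathcal K$ satisfying Green's identity with $(\Gamma_0,\Gamma_1):A^*\to\mathcal K^2$ surjective; its Weyl function is defined by $M_0(\lambda)\Gamma_0\hat f=\Gamma_1\hat f$ for $\hat f=\{f,\lambda f\}\in A^*$. *)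

(* Defs.v *)
(* complex scalars R[i] (mathcomp-real-closed) over R : realType. *)
From HB Require Import structures.
From mathcomp Require Import all_boot all_order all_algebra.
From mathcomp Require Import reals complex.
Set Implicit Arguments. Unset Strict Implicit. Unset Printing Implicit Defensive.
Import Order.TTheory GRing.Theory Num.Theory.
Local Open Scope ring_scope.

(* ---------- Complex Hilbert spaces ------------------------------------- *)
(* A Hilbert space is an lmodType over R[i] with an inner product that is   *)
(* linear in the first and antilinear in the second argument, hermitian,   *)
(* positive definite, and complete for the induced norm.                   *)

Definition iC {R : realType} : R[i] := Complex 0 1.

(* squared norm ||x||^2 = Re (x,x) *)
Definition nrm2 {R : realType} {V : lmodType R[i]} (ip : V -> V -> R[i]) (x : V) : R :=
  complex.Re (ip x x).

Definition seq_conv {R : realType} {V : lmodType R[i]} (ip : V -> V -> R[i])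
  (u : nat -> V) (x : V) : Prop :=
  forall e : R, 0 < e -> exists N : nat, forall n, (N <= n)%N -> nrm2 ip (u n - x) < e.

Definition seq_cauchy {R : realType} {V : lmodType R[i]} (ip : V -> V -> R[i])
  (u : nat -> V) : Prop :=
  forall e : R, 0 < e -> exists N : nat, forall m n, (N <= m)%N -> (N <= n)%N ->
    nrm2 ip (u m - u n) < e.

Definition is_hilbert {R : realType} {V : lmodType R[i]} (ip : V -> V -> R[i]) : Prop :=
  [/\ (forall (a : R[i]) x y z, ip (a *: x + y) z = a * ip x z + ip y z),
      (forall x y, ip y x = (ip x y)^*),
      (forall x, 0 <= ip x x),
      (forall x, ip x x = 0 -> x = 0)
    & (forall u, seq_cauchy ip u -> exists x, seq_conv ip u x)].

(* ---------- Linear relations ------------------------------------------- *)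

(* a linear relation in V (subspace of V^2), given as a predicate on pairs *)
Definition linrel {R : realType} {V : lmodType R[i]} (T : V -> V -> Prop) : Prop :=
  T 0 0 /\ (
      forall (a : R[i]) f f' g g', T f f' -> T g g' -> T (a *: f + g) (a *: f' + g')).

(* closed relation: closed in V^2 *)
Definition closed_rel {R : realType} {V : lmodType R[i]} (ip : V -> V -> R[i])
  (T : V -> V -> Prop) : Prop :=
  forall (u v : nat -> V) f f', (forall n, T (u n) (v n)) ->
    seq_conv ip u f -> seq_conv ip v f' -> T f f'.

(* adjoint relation T^* = {(g,g') : (f',g) = (f,g') for all (f,f') in T} *)
Definition adj_rel {R : realType} {V : lmodType R[i]} (ip : V -> V -> R[i])
  (T : V -> V -> Prop) (g g' : V) : Prop :=
  forall f f', T f f' -> ip f' g = ip f g'.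

(* symmetric relation: T is contained in T^* *)
Definition symmetric_rel {R : realType} {V : lmodType R[i]} (ip : V -> V -> R[i])
  (T : V -> V -> Prop) : Prop :=
  forall f f', T f f' -> adj_rel ip T f f'.

Definition selfadjoint_rel {R : realType} {V : lmodType R[i]} (ip : V -> V -> R[i])
  (T : V -> V -> Prop) : Prop :=
  forall g g', T g g' <-> adj_rel ip T g g'.

(* ---------- B-generalized boundary pairs ------------------------------- *)
(* Gam f f' h h'  <->  {{f,f'},{h,h'}} \in Gamma  (Gamma : frak_h^2 -> calH^2) *)

Definition ker_Gam0 {R : realType} {K H : lmodType R[i]}
  (Gam : K -> K -> H -> H -> Prop) (f f' : K) : Prop :=
  exists h' : H, Gam f f' 0 h'.

Definition B_gen_boundary_pair {R : realType} {K H : lmodType R[i]}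
  (ipK : K -> K -> R[i]) (ipH : H -> H -> R[i]) (A : K -> K -> Prop)
  (Gam : K -> K -> H -> H -> Prop) : Prop :=
  (* Gamma is a linear relation *)
  (Gam 0 0 0 0 /\
      (forall (a : R[i]) f f' h h' g g' k k', Gam f f' h h' -> Gam g g' k k' ->
          Gam (a *: f + g) (a *: f' + g') (a *: h + k) (a *: h' + k'))) /\
  [/\ (* dom Gamma is contained in A^* *)
      (forall f f' h h', Gam f f' h h' -> adj_rel ipK A f f'),
      (* dom Gamma is dense in A^* *)
      (forall f f', adj_rel ipK A f f' -> forall e : R, 0 < e ->
          exists g g' k k', Gam g g' k k' /\ nrm2 ipK (f - g) + nrm2 ipK (f' - g') < e),
      (* Green's identity *)
      (forall f f' h h' g g' k k', Gam f f' h h' -> Gam g g' k k' ->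
          ipK f' g - ipK f g' = ipH h' k - ipH h k'),
      (* ran Gamma_0 = calH *)
      (forall h, exists f f' h', Gam f f' h h')
    & (* ker Gamma_0 is selfadjoint *)
      selfadjoint_rel ipK (ker_Gam0 Gam)].

(* Weyl family M(lambda) = {hh : {{f, lambda f}, hh} \in Gamma}, as a relation in calH *)
Definition weyl_family {R : realType} {K H : lmodType R[i]}
  (Gam : K -> K -> H -> H -> Prop) (l : R[i]) (h h' : H) : Prop :=
  exists f : K, Gam f (l *: f) h h'.

(* range of Im T = (T - T^* )/(2i), with the operator sum of linear relations *)
Definition ran_Im_rel {R : realType} {H : lmodType R[i]} (ipH : H -> H -> R[i])
  (T : H -> H -> Prop) (x : H) : Prop :=
  exists h h1 h2, T h h1 /\ adj_rel ipH T h h2 /\ x = (2 * iC)^-1 *: (h1 - h2).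

(* closure of a set in calH *)
Definition closure_set {R : realType} {H : lmodType R[i]} (ipH : H -> H -> R[i])
  (S : H -> Prop) (x : H) : Prop :=
  forall e : R, 0 < e -> exists y, S y /\ nrm2 ipH (x - y) < e.

(* calH_s(lambda) = closure of ran Im M(lambda) *)
Definition Hs_of {R : realType} {K H : lmodType R[i]} (ipH : H -> H -> R[i])
  (Gam : K -> K -> H -> H -> Prop) (l : R[i]) : H -> Prop :=
  closure_set ipH (ran_Im_rel ipH (weyl_family Gam l)).

(* ---------- Ordinary boundary triples with boundary space a closed ----- *)
(* subspace S of calH (with the inner product of calH).                    *)
(* G0 f f' = Gamma_0 {f,f'}, G1 f f' = Gamma_1 {f,f'}, for {f,f'} in A^*.   *)
Definition ordinary_boundary_triple {R : realType} {K H : lmodType R[i]}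
  (ipK : K -> K -> R[i]) (ipH : H -> H -> R[i]) (A : K -> K -> Prop)
  (S : H -> Prop) (G0 G1 : K -> K -> H) : Prop :=
  [/\ (* linear maps A^* -> S *)
      (forall (a : R[i]) f f' g g', adj_rel ipK A f f' -> adj_rel ipK A g g' ->
          G0 (a *: f + g) (a *: f' + g') = a *: G0 f f' + G0 g g' /\
          G1 (a *: f + g) (a *: f' + g') = a *: G1 f f' + G1 g g'),
      (forall f f', adj_rel ipK A f f' -> S (G0 f f') /\ S (G1 f f')),
      (* Green's identity *)
      (forall f f' g g', adj_rel ipK A f f' -> adj_rel ipK A g g' ->
          ipK f' g - ipK f g' = ipH (G1 f f') (G0 g g') - ipH (G0 f f') (G1 g g'))
    & (* (Gamma_0, Gamma_1) : A^* -> S^2 is surjective *)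
      (forall x y, S x -> S y ->
          exists f f', adj_rel ipK A f f' /\ G0 f f' = x /\ G1 f f' = y)].

(* Weyl function M_0(lambda) of an ordinary triple, as a relation in S:   *)
(* M_0(lambda) Gamma_0 fh = Gamma_1 fh for fh = {f, lambda f} in A^*      *)
Definition weyl_fun0 {R : realType} {K H : lmodType R[i]}
  (ipK : K -> K -> R[i]) (A : K -> K -> Prop) (G0 G1 : K -> K -> H)
  (l : R[i]) (x y : H) : Prop :=
  exists f : K, adj_rel ipK A f (l *: f) /\ G0 f (l *: f) = x /\ G1 f (l *: f) = y.

(* bounded linear operators *)
Definition bounded_linear {R : realType} {V W : lmodType R[i]}
  (ipV : V -> V -> R[i]) (ipW : W -> W -> R[i]) (T : V -> W) : Prop :=
  (forall (a : R[i]) x y, T (a *: x + y) = a *: T x + T y) /\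
  exists c : R, forall x, nrm2 ipW (T x) <= c * nrm2 ipV x.

Definition nonreal {R : realType} (l : R[i]) : Prop := complex.Im l != 0.

(* Main.v *)
(** Put [A0 = ker Gamma_0], [gamma(l) h = f] when [{f, l f}] has [Gamma_0]-value [h], and
    [M(l)] the Weyl function; both are everywhere defined because [ran (A0 - l)] is the
    whole space.  Green's identity gives [Im M(l) = Im l . gamma(l)^* gamma(l)], so
    [ker Im M(l) = {h | {0, h} in Gamma_0}] is the same for all nonreal [l], and
    [H_s] is its orthogonal complement.

    At [l = i] let [E = Re M(i)] and let [G] be a selfadjoint square root of [Im M(i)];
    boundedness is Hellinger-Toeplitz.  The map [gamma(i) h |-> G h] extends to a unitary from the
    defect space [N_i = ker (A^* - i)] onto [H_s], and by [0] to a partial isometry [J]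
    on the whole space.  Decomposing [{f,f'} = {f0,f0'} + {a, i a}] along [A^* = A0 + N_i],
    the triple is [Gamma^0_0 = J a] and [Gamma^0_1 = J (i a + f0' + i f0)]: for
    [{f0,f0'}] in [A0] and [k] in [H], Green's identity reads
    [(Gamma_1 {f0,f0'}, k) = (f0' + i f0, gamma(i) k) = (G J (f0' + i f0), k)]. *)
Require Import Defs.
From HB Require Import structures.
From mathcomp Require Import all_boot all_order all_algebra.
From mathcomp Require Import reals complex.
From mathcomp Require Import boolp classical_sets topology normedtype sequences.
From mathcomp Require Import ring lra.
Import Order.TTheory GRing.Theory Num.Theory.
Import numFieldNormedType.Exports.
Local Open Scope ring_scope.
Set Implicit Arguments. Unset Strict Implicit. Unset Printing Implicit Defensive.

(** * Inner product and norm of a complex Hilbert space *)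

Section InnerProduct.
Variables (R : realType) (V : lmodType R[i]) (ip : V -> V -> R[i]).
Hypothesis hV : is_hilbert ip.
Implicit Types (x y z : V) (a : R[i]) (c : R).

Lemma ipPl a x y z : ip (a *: x + y) z = a * ip x z + ip y z.
Proof. by case: hV. Qed.

Lemma ipC x y : ip y x = (ip x y)^*.
Proof. by case: hV. Qed.

Lemma ip0l z : ip 0 z = 0.
Proof.
have /eqP := ipPl 1 0 0 z.
by rewrite scaler0 add0r mul1r -subr_eq0 opprD addrA subrr add0r oppr_eq0 => /eqP.
Qed.

Lemma ipDl x y z : ip (x + y) z = ip x z + ip y z.
Proof. by rewrite -{1}[x]scale1r ipPl mul1r. Qed.

Lemma ipZl a x z : ip (a *: x) z = a * ip x z.
Proof. by rewrite -[a *: x]addr0 ipPl ip0l addr0. Qed.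

Lemma ipNl x z : ip (- x) z = - ip x z.
Proof. by rewrite -scaleN1r ipZl mulN1r. Qed.

Lemma ipBl x y z : ip (x - y) z = ip x z - ip y z.
Proof. by rewrite ipDl ipNl. Qed.

Lemma ip0r z : ip z 0 = 0.
Proof. by rewrite ipC ip0l rmorph0. Qed.

Lemma ipDr x y z : ip z (x + y) = ip z x + ip z y.
Proof. by rewrite ipC ipDl rmorphD /= -!ipC. Qed.

Lemma ipZr a x z : ip z (a *: x) = a^* * ip z x.
Proof. by rewrite ipC ipZl rmorphM /= -ipC. Qed.

(* The metric theory uses only the real inner product [rip]; [ipE] recovers [ip] from it. *)
Definition rip x y : R := complex.Re (ip x y).

Lemma ReE (z w : R[i]) : complex.Re (z + w) = complex.Re z + complex.Re w.
Proof. by case: z; case: w. Qed.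

Lemma nrm2E x : nrm2 ip x = rip x x. Proof. by []. Qed.

Lemma ripC x y : rip y x = rip x y.
Proof. by rewrite /rip ipC; case: (ip x y). Qed.

Lemma ripDl x y z : rip (x + y) z = rip x z + rip y z.
Proof. by rewrite /rip ipDl ReE. Qed.

Lemma ripNl x z : rip (- x) z = - rip x z.
Proof. by rewrite /rip ipNl; case: (ip x z). Qed.

Lemma ripBl x y z : rip (x - y) z = rip x z - rip y z.
Proof. by rewrite ripDl ripNl. Qed.

Lemma ripDr x y z : rip z (x + y) = rip z x + rip z y.
Proof. by rewrite ripC ripDl !(ripC z). Qed.

Lemma ripNr x z : rip z (- x) = - rip z x.
Proof. by rewrite ripC ripNl (ripC z). Qed.

Lemma ripBr x y z : rip z (x - y) = rip z x - rip z y.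
Proof. by rewrite ripDr ripNr. Qed.

Lemma ripZl c x y : rip (c%:C%C *: x) y = c * rip x y.
Proof. by rewrite /rip ipZl; case: (ip x y) => a b /=; ring. Qed.

Lemma ripZr c x y : rip y (c%:C%C *: x) = c * rip y x.
Proof. by rewrite ripC ripZl ripC. Qed.

Lemma rip0l x : rip 0 x = 0.
Proof. by rewrite /rip ip0l. Qed.

Lemma rip0r x : rip x 0 = 0.
Proof. by rewrite /rip ip0r. Qed.

(** Antilinearity in the second argument turns [iC] into [- iC], and the real part of -i z is the
    imaginary part of z. *)
Lemma ipE x y : ip x y = Complex (rip x y) (rip x (iC *: y)).
Proof.
rewrite /rip ipZr; case: (ip x y) => a b /=.
by congr Complex; ring.
Qed.

Lemma nrm2_ge0 x : 0 <= nrm2 ip x.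
Proof.
have [_ _ h _ _] := hV; have := h x.
by rewrite lecE => /andP[].
Qed.

Lemma nrm2_eq0 x : nrm2 ip x = 0 -> x = 0.
Proof.
have [_ _ h h0 _] := hV => hx; apply: h0; have := h x.
rewrite lecE => /andP[/eqP hi _]; move: hx hi; rewrite /nrm2.
by case: (ip x x) => a b /= -> ->.
Qed.

Lemma nrm2D x y : nrm2 ip (x + y) = nrm2 ip x + nrm2 ip y + 2 * rip x y.
Proof. by rewrite !nrm2E ripDl !ripDr (ripC x y); ring. Qed.

Lemma nrm2B x y : nrm2 ip (x - y) = nrm2 ip x + nrm2 ip y - 2 * rip x y.
Proof. by rewrite !nrm2E ripBl !ripBr (ripC x y); ring. Qed.

Lemma nrm2Z a x :
  nrm2 ip (a *: x) = (complex.Re a ^+ 2 + complex.Im a ^+ 2) * nrm2 ip x.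
Proof.
rewrite /nrm2 ipZl ipZr mulrA.
have : complex.Im (ip x x) = 0.
  have [_ _ h _ _] := hV; have := h x.
  by rewrite lecE => /andP[/eqP ->].
by case: a (ip x x) => a b [c d] /= ->; ring.
Qed.

Lemma nrm2_iC x : nrm2 ip (iC *: x) = nrm2 ip x.
Proof. by rewrite nrm2Z /=; ring. Qed.

Lemma nrm2_opp x : nrm2 ip (- x) = nrm2 ip x.
Proof. by rewrite !nrm2E ripNl ripNr opprK. Qed.

Lemma nrm2C x y : nrm2 ip (x - y) = nrm2 ip (y - x).
Proof. by rewrite -nrm2_opp opprB. Qed.

Lemma rip_ext x y : (forall z, rip x z = rip y z) -> x = y.
Proof.
move=> h; apply/eqP; rewrite -subr_eq0; apply/eqP; apply: nrm2_eq0.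
by rewrite nrm2E ripBl h subrr.
Qed.

(** For [y] nonzero, this is nonnegativity of the squared distance from [x] to its projection onto
    the real line of [y], multiplied by [nrm2 ip y]. *)
Lemma cauchy_schwarz2 x y : rip x y ^+ 2 <= nrm2 ip x * nrm2 ip y.
Proof.
have [y0|y0] := eqVneq (nrm2 ip y) 0.
  by rewrite (nrm2_eq0 y0) rip0r (nrm2E 0) rip0l mulr0 expr0n.
have py : 0 < nrm2 ip y by rewrite lt_neqAle eq_sym y0 nrm2_ge0.
have := nrm2_ge0 (x - (rip x y / nrm2 ip y)%:C%C *: y).
rewrite nrm2B nrm2Z /= ripZr expr0n addr0 => h.
have := mulr_ge0 h (ltW py).
suff -> : (nrm2 ip x + (rip x y / nrm2 ip y) ^+ 2 * nrm2 ip y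
   - 2 * (rip x y / nrm2 ip y * rip x y)) * nrm2 ip y =
  nrm2 ip x * nrm2 ip y - rip x y ^+ 2 by rewrite subr_ge0.
by field.
Qed.

Definition nrm x : R := Num.sqrt (nrm2 ip x).

Lemma nrm_ge0 x : 0 <= nrm x. Proof. exact: sqrtr_ge0. Qed.

Lemma nrm_sqr x : nrm x ^+ 2 = nrm2 ip x.
Proof. by rewrite sqr_sqrtr ?nrm2_ge0. Qed.

Lemma nrm_eq0 x : nrm x = 0 -> x = 0.
Proof. by move=> h; apply: nrm2_eq0; rewrite -nrm_sqr h expr0n. Qed.

Lemma nrm0 : nrm 0 = 0.
Proof. by rewrite /nrm nrm2E rip0l sqrtr0. Qed.

Lemma cauchy_schwarz x y : `|rip x y| <= nrm x * nrm y.
Proof.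
rewrite -(@ler_pXn2r _ 2) ?nnegrE ?mulr_ge0 ?nrm_ge0 //.
by rewrite exprMn !nrm_sqr real_normK ?num_real // cauchy_schwarz2.
Qed.

Lemma rip_le x y : rip x y <= nrm x * nrm y.
Proof. exact: le_trans (ler_norm _) (cauchy_schwarz x y). Qed.

Lemma nrmD x y : nrm (x + y) <= nrm x + nrm y.
Proof.
rewrite -(@ler_pXn2r _ 2) ?nnegrE ?addr_ge0 ?nrm_ge0 //.
rewrite nrm_sqr nrm2D -!nrm_sqr.
have := rip_le x y; nra.
Qed.

Lemma nrmN x : nrm (- x) = nrm x.
Proof. by rewrite /nrm nrm2_opp. Qed.

Lemma nrmBC x y : nrm (x - y) = nrm (y - x).
Proof. by rewrite -nrmN opprB. Qed.

Lemma nrmB_trans y x z : nrm (x - z) <= nrm (x - y) + nrm (y - z).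
Proof. by rewrite (_ : x - z = (x - y) + (y - z)) ?nrmD // addrA subrK. Qed.

Lemma nrm_iC x : nrm (iC *: x) = nrm x.
Proof. by rewrite /nrm nrm2_iC. Qed.

Lemma nrmZ c x : nrm (c%:C%C *: x) = `|c| * nrm x.
Proof. by rewrite /nrm nrm2Z /= expr0n addr0 sqrtrM ?sqr_ge0 // sqrtr_sqr. Qed.

Lemma nrm_dist x y : `|nrm x - nrm y| <= nrm (x - y).
Proof.
have h1 : nrm x <= nrm (x - y) + nrm y by rewrite -{1}[x](subrK y) nrmD.
have h2 : nrm y <= nrm (x - y) + nrm x by rewrite -{1}[y](subrK x) nrmBC nrmD.
by rewrite ler_norml; apply/andP; split; lra.
Qed.

Lemma parallelogram x y :
  nrm2 ip (x + y) + nrm2 ip (x - y) = 2 * nrm2 ip x + 2 * nrm2 ip y.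
Proof. by rewrite nrm2D nrm2B; ring. Qed.

Lemma nrm2_lt x c : 0 < c -> nrm2 ip x < c ^+ 2 -> nrm x < c.
Proof.
move=> c0; rewrite -nrm_sqr => h; rewrite ltNge; apply/negP => h1.
have := nrm_ge0 x; nra.
Qed.

Lemma lt_nrm2 x c : nrm x < c -> nrm2 ip x < c ^+ 2.
Proof. by rewrite -nrm_sqr; have := nrm_ge0 x => h1 h2; nra. Qed.

Lemma seq_convP (u : nat -> V) x : seq_conv ip u x <->
  forall e : R, 0 < e -> exists N : nat, forall n, (N <= n)%N -> nrm (u n - x) < e.
Proof.
split=> h e e0.
  have [N hN] := h (e ^+ 2) (exprn_gt0 2 e0).
  by exists N => n /hN; apply: nrm2_lt.
have e1 : 0 < Num.sqrt e by rewrite sqrtr_gt0.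
have [N hN] := h _ e1.
by exists N => n /hN /lt_nrm2; rewrite sqr_sqrtr // ltW.
Qed.

Lemma seq_cauchyP (u : nat -> V) : seq_cauchy ip u <->
  forall e : R, 0 < e -> exists N : nat, forall m n, (N <= m)%N -> (N <= n)%N ->
    nrm (u m - u n) < e.
Proof.
split=> h e e0.
  have [N hN] := h (e ^+ 2) (exprn_gt0 2 e0).
  by exists N => m n hm hn; apply: nrm2_lt => //; apply: hN.
have e1 : 0 < Num.sqrt e by rewrite sqrtr_gt0.
have [N hN] := h _ e1.
by exists N => m n hm hn; have /lt_nrm2 := hN m n hm hn; rewrite sqr_sqrtr // ltW.
Qed.

Lemma nrm2_le_sqr x c : 0 <= c -> nrm2 ip x <= c ^+ 2 -> nrm x <= c.
Proof.
by move=> c0; rewrite -nrm_sqr ler_pXn2r ?nnegrE ?nrm_ge0.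
Qed.

End InnerProduct.

(** * Limits, orthogonal projections, closures and the Hellinger-Toeplitz theorem *)

Section Limits.
Variables (R : realType) (V : lmodType R[i]) (ip : V -> V -> R[i]).
Hypothesis hV : is_hilbert ip.
Implicit Types (x y z : V) (u v : nat -> V).
Local Notation nrm := (nrm ip).
Local Notation rip := (rip ip).

Lemma conv_cst x : seq_conv ip (fun _ => x) x.
Proof. by move=> e e0; exists 0%N => n _; rewrite subrr nrm2E rip0l. Qed.

Lemma conv_nrm0P u x : seq_conv ip u x <-> (nrm (u n - x) @[n --> \oo] --> (0 : R))%classic.
Proof.
rewrite (seq_convP hV); split=> h.
  apply/cvgrPdist_lt => e /h[N hN]; exists N => // n /= /hN.
  by rewrite sub0r normrN ger0_norm ?nrm_ge0.
move/cvgrPdist_lt: h => h e /h[N _ hN]; exists N => n /hN /=.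
by rewrite sub0r normrN ger0_norm ?nrm_ge0.
Qed.

Lemma conv_uniq u x y : seq_conv ip u x -> seq_conv ip u y -> x = y.
Proof.
move=> /(seq_convP hV) hx /(seq_convP hV) hy; apply/eqP; rewrite -subr_eq0.
apply/eqP/(nrm_eq0 hV)/eqP; rewrite eq_le nrm_ge0 andbT leNgt; apply/negP => h.
have h2 : 0 < nrm (x - y) / 2 by rewrite divr_gt0.
have [N1 hN1] := hx _ h2; have [N2 hN2] := hy _ h2.
have := hN1 _ (leq_maxl N1 N2); have := hN2 _ (leq_maxr N1 N2).
have := nrmB_trans hV (u (maxn N1 N2)) x y.
by rewrite (nrmBC hV x (u _)); lra.
Qed.

Lemma conv_lin a u v x y : seq_conv ip u x -> seq_conv ip v y ->
  seq_conv ip (fun n => a *: u n + v n) (a *: x + y).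
Proof.
move=> /conv_nrm0P hx /conv_nrm0P hy; apply/conv_nrm0P.
(* The modulus of [a], as an element of [R]. *)
pose c : R := Num.sqrt (complex.Re a ^+ 2 + complex.Im a ^+ 2).
have hc z : nrm (a *: z) = c * nrm z.
  by rewrite /nrm nrm2Z // sqrtrM // addr_ge0 // sqr_ge0.
apply: (@squeeze_cvgr _ _ _ _ (fun _ => 0) (fun n => c * nrm (u n - x) + nrm (v n - y))).
- apply: nearW => n; rewrite nrm_ge0 /= opprD addrACA -scalerBr -hc.
  exact: nrmD.
- exact: cvg_cst.
- rewrite -[X in (_ --> X)%classic](_ : c * 0 + 0 = 0); last by ring.
  by apply: cvgD => //; apply: cvgM => //; apply: cvg_cst.
Qed.

Lemma convB u v x y : seq_conv ip u x -> seq_conv ip v y ->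
  seq_conv ip (fun n => u n - v n) (x - y).
Proof.
move=> hu hv; have := conv_lin (-1) hv hu; rewrite scaleN1r addrC.
by under eq_fun do rewrite scaleN1r addrC.
Qed.

Lemma conv_nrm u x : seq_conv ip u x -> (nrm (u n) @[n --> \oo] --> nrm x)%classic.
Proof.
move=> /(seq_convP hV) h; apply/cvgrPdist_lt => e /h[N hN].
exists N => // n /= /hN; apply: le_lt_trans.
by rewrite (nrmBC hV); apply: nrm_dist.
Qed.

(** Polarization reduces continuity of the product to continuity of the norm. *)
Lemma conv_rip u v x y : seq_conv ip u x -> seq_conv ip v y ->
  (rip (u n) (v n) @[n --> \oo] --> rip x y)%classic.
Proof.
have pol z w : rip z w = (nrm (1 *: z + w) * nrm (1 *: z + w)
    - nrm ((-1) *: z + w) * nrm ((-1) *: z + w)) / 4.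
  rewrite -!expr2 !nrm_sqr // scale1r scaleN1r [- z + w]addrC.
  by rewrite nrm2D // nrm2B // (ripC hV z w); field.
move=> hu hv; rewrite pol.
rewrite (_ : (fun n => _) = (fun n => (nrm (1 *: u n + v n) * nrm (1 *: u n + v n)
    - nrm ((-1) *: u n + v n) * nrm ((-1) *: u n + v n)) / 4)); last first.
  by apply/funext => n; rewrite pol.
have h1 := conv_nrm (conv_lin 1 hu hv).
have h2 := conv_nrm (conv_lin (-1) hu hv).
by apply: cvgM; [apply: cvgB; apply: cvgM | apply: cvg_cst].
Qed.

Lemma conv_cauchy u x : seq_conv ip u x -> seq_cauchy ip u.
Proof.
move=> /(seq_convP hV) h; apply/(seq_cauchyP hV) => e e0.
have e2 : 0 < e / 2 by rewrite divr_gt0.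
have [N hN] := h _ e2; exists N => m n /hN h1 /hN h2.
have := nrmB_trans hV x (u m) (u n).
by rewrite (nrmBC hV x (u _)); lra.
Qed.

Lemma cauchy_conv u : seq_cauchy ip u -> exists x, seq_conv ip u x.
Proof. by case: hV => _ _ _ _; apply. Qed.

Lemma conv_nrm_le u x y c : seq_conv ip u x ->
  (exists N, forall n, (N <= n)%N -> nrm (u n - y) <= c) -> nrm (x - y) <= c.
Proof.
move=> /(seq_convP hV) hu [N hN]; apply/ler_addgt0Pr => e /hu[M hM].
have := hN _ (leq_maxl N M); have := hM _ (leq_maxr N M).
have := nrmB_trans hV (u (maxn N M)) x y.
by rewrite (nrmBC hV x (u _)); lra.
Qed.

Definition closed_subspace (S : V -> Prop) : Prop :=
  [/\ S 0, (forall a x y, S x -> S y -> S (a *: x + y)) &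
      forall u x, (forall n, S (u n)) -> seq_conv ip u x -> S x].

Lemma ip_eq0 x y : rip x y = 0 -> rip x (iC *: y) = 0 -> ip x y = 0.
Proof. by move=> h1 h2; rewrite (ipE hV) h1 h2. Qed.

Lemma harmonic_lt (e : R) : 0 < e -> exists N, forall n, (N <= n)%N -> n.+1%:R^-1 < e.
Proof.
move=> e0; have /cvgrPdist_lt/(_ e e0)[N _ hN] := @cvg_harmonic R.
exists N => n /hN /=; rewrite sub0r normrN ger0_norm //.
by rewrite /harmonic invr_ge0.
Qed.

(** A sequence in [S] whose squared distances to [x] approach their infimum is Cauchy by the
    parallelogram law; its limit attains the infimum, and a variation of the minimizer gives
    orthogonality. *)
Theorem projection (S : V -> Prop) x : closed_subspace S ->
  exists2 p, S p & forall s, S s -> ip (x - p) s = 0.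
Proof.
case=> S0 Slin Scl.
pose E : set R := [set nrm2 ip (x - s) | s in S]%classic.
have Einf : has_inf E.
  split; first by exists (nrm2 ip (x - 0)), 0.
  by exists 0 => _ [s _ <-]; apply: nrm2_ge0.
pose D := inf E.
have Dle s : S s -> D <= nrm2 ip (x - s).
  by move=> hs; apply: ge_inf; [exact: Einf.2 | exists s].
have /choice[s hs] n : exists s, S s /\ nrm2 ip (x - s) < D + n.+1%:R^-1.
  have n0 : 0 < n.+1%:R^-1 :> R by rewrite invr_gt0.
  by have [_ [s hs <-] h] := inf_adherent n0 Einf; exists s.
have mid m n : nrm2 ip (s m - s n) <= 2 * (m.+1%:R^-1 + n.+1%:R^-1).
  have hp := parallelogram hV (x - s m) (x - s n).
  (* The trailing [0] lets the midpoint be built by two uses of [Slin]. *)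
  have hm : x - s m + (x - s n) = 2%:C%C *: (x - (2^-1 *: s m + (2^-1 *: s n + 0))).
    rewrite addr0 -scalerDr scalerBr scalerA [2%:C%C](_ : _ = 2); last first.
      by rewrite (rmorph_nat (real_complex R)).
    by rewrite mulfV ?pnatr_eq0 // scale1r scaler_nat mulr2n opprD addrACA.
  have hS : S (2^-1 *: s m + (2^-1 *: s n + 0)).
    by apply: (Slin); [exact: (hs m).1 | apply: (Slin) => //; exact: (hs n).1].
  have := Dle _ hS; have := (hs m).2; have := (hs n).2.
  have hd : x - s m - (x - s n) = s n - s m by rewrite opprB addrC addrA subrK.
  move: hp; rewrite hm hd nrm2Z //= (nrm2C hV (s n)).
  by move: n.+1%:R^-1 m.+1%:R^-1 (nrm2 ip (x - (_ + _))) => e1 e2 Q; lra.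
have [p hp] : exists p, seq_conv ip s p.
  apply: cauchy_conv => e e0; have e4 : 0 < e / 4 by rewrite divr_gt0.
  have [N hN] := harmonic_lt e4; exists N => m n hm hn.
  apply: le_lt_trans (mid m n) _.
  by have := hN _ hm; have := hN _ hn; move: n.+1%:R^-1 m.+1%:R^-1 => e1 e2; lra.
have Sp : S p by apply: Scl hp => n; exact: (hs n).1.
exists p => //.
have hD : nrm2 ip (x - p) <= D.
  have hc := convB (conv_cst x) hp; have {}hc := conv_rip hc hc.
  apply/ler_addgt0Pr => e e0; have e2 : 0 < e / 2 by rewrite divr_gt0.
  have /cvgrPdist_lt/(_ _ e2)[N1 _ hN1] := hc; have [N2 hN2] := harmonic_lt e2.
  have := hN1 (maxn N1 N2) (leq_maxl _ _); have := hN2 _ (leq_maxr N1 N2).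
  have := (hs (maxn N1 N2)).2; rewrite /= ltr_norml -!nrm2E.
  move: (maxn _ _).+1%:R^-1 => e1; move: (nrm2 ip (x - p)) (nrm2 ip _) => q q'.
  by move=> h1 h2 /andP[_ h3]; lra.
have orth t : S t -> rip (x - p) t = 0.
  move=> St; apply/eqP; apply/negPn/negP => r0.
  set r := rip (x - p) t in r0; set q := nrm2 ip t.
  have q0 : 0 <= q by apply: nrm2_ge0.
  (* Moving [p] by [w *: t] with [w = r / (q + 1)] changes the squared distance by
     [w^2 q - 2 w r = - w^2 (q + 2)], which is negative; the [+ 1] keeps the denominator
     positive. *)
  have hSt : S ((r / (q + 1))%:C%C *: t + p) by apply: Slin.
  have := Dle _ hSt; rewrite opprD addrCA addrC nrm2B // nrm2Z //= ripZr // -/r -/q => h.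
  have q1 : 0 < q + 1 by lra.
  have r2 : 0 < r ^+ 2 by rewrite exprn_even_gt0.
  set w := r / (q + 1) in h; have hw : r = w * (q + 1) by rewrite /w; field; lra.
  have w2 : 0 < w ^+ 2.
    by rewrite exprn_even_gt0 //= /w mulf_neq0 // invr_neq0 // gt_eqF.
  by rewrite hw in h; nra.
(* The imaginary part of the product vanishes because [iC *: t] lies in [S] too. *)
move=> t St; apply: ip_eq0; apply: orth => //.
by rewrite -[_ *: t]addr0; apply: Slin.
Qed.

Lemma closure_seqP (S : V -> Prop) x : closure_set ip S x <->
  exists2 u, (forall n, S (u n)) & seq_conv ip u x.
Proof.
split=> [h|[u hu /(_ _ _)hx] e e0]; last first.
  have [N hN] := hx e e0; exists (u N); split=> //.
  by rewrite nrm2C //; apply: hN.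
have /choice[u hu] (n : nat) : exists y, S y /\ nrm2 ip (x - y) < n.+1%:R^-1.
  by apply: h; rewrite invr_gt0.
exists u => [n|e /harmonic_lt[N hN]]; first exact: (hu n).1.
by exists N => n /hN; apply: lt_trans; rewrite nrm2C //; exact: (hu n).2.
Qed.

Lemma closure_closed (S : V -> Prop) : S 0 ->
  (forall a x y, S x -> S y -> S (a *: x + y)) -> closed_subspace (closure_set ip S).
Proof.
move=> S0 Sl; split.
- by apply/closure_seqP; exists (fun=> 0) => //; apply: conv_cst.
- move=> a x y /closure_seqP[u hu hux] /closure_seqP[v hv hvy]; apply/closure_seqP.
  by exists (fun n => a *: u n + v n) => [n|]; [apply: Sl | apply: conv_lin].
- move=> u x hu /(seq_convP hV) hux e e0.
  pose d := Num.sqrt e; have d0 : 0 < d by rewrite sqrtr_gt0.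
  have d2 : 0 < d / 2 by rewrite divr_gt0.
  have [N hN] := hux _ d2; have := hN N (leqnn _) => h1.
  have [y [Sy hy]] := hu N _ (exprn_gt0 2 d2); exists y; split=> //.
  have {}hy := nrm2_lt hV d2 hy.
  have -> : e = d ^+ 2 by rewrite sqr_sqrtr // ltW.
  apply: lt_nrm2 => //; have := nrmB_trans hV (u N) x y.
  by rewrite (nrmBC hV x (u _)); lra.
Qed.

Lemma closure_ip0 (S : V -> Prop) x y :
  (forall s, S s -> ip s y = 0) -> closure_set ip S x -> ip x y = 0.
Proof.
move=> h /closure_seqP[u hu hx].
have key z : (forall s, S s -> rip s z = 0) -> rip x z = 0.
  move=> hz; apply: (cvg_unique _ (conv_rip hx (conv_cst z))) => //.
  rewrite (_ : (fun n => _) = (fun=> 0)); first exact: cvg_cst.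
  by apply/funext => n; rewrite hz.
apply: ip_eq0; apply: key => s /h hs; first by rewrite /rip hs.
by rewrite /rip ipZr // hs mulr0.
Qed.

(* Gliding hump: if [T] were unbounded, a series of steps of length [3^-n] along [T (Y n)],
   with signs chosen so that each step is felt by the functional [rip _ (T (Y n))] and not undone
   by the later ones, would produce a vector [x] with [nrm (T x) >= n] for all [n]. *)
Theorem Hellinger_Toeplitz (T : V -> V) : (forall x y, rip (T x) y = rip x (T y)) ->
  exists2 c : R, 0 < c & forall x, nrm (T x) <= c * nrm x.
Proof.
move=> hT; apply: contrapT => hb.
(* The factor [2 * 3 ^+ n] is what the estimate [h7] loses, so that [n%:R] survives as a lower
   bound. *)
have /choice[Y hY] (n : nat) : exists y, n%:R * (2 * 3 ^+ n) * nrm y < nrm (T y).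
  apply: contrapT => h; apply: hb; exists (n%:R * (2 * 3 ^+ n) + 1).
    by rewrite ltr_wpDl // mulr_ge0 // mulr_ge0 // exprn_ge0.
  move=> x; have : ~ (n%:R * (2 * 3 ^+ n) * nrm x < nrm (T x)).
    by move=> hx; apply: h; exists x.
  by move/negP; rewrite -leNgt => hx; have := nrm_ge0 ip x; lra.
pose t n := nrm (T (Y n)).
have t0 n : 0 < t n.
  by apply: le_lt_trans (hY n); rewrite !mulr_ge0 ?nrm_ge0 ?exprn_ge0.
pose step n := ((3^-1) ^+ n / t n)%:C%C *: T (Y n).
have step_nrm n : nrm (step n) = (3^-1) ^+ n.
  rewrite /step nrmZ // -/(t n) ger0_norm ?divr_ge0 ?exprn_ge0 ?invr_ge0 ?(ltW (t0 n)) //.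
  by rewrite divfK // gt_eqF.
have step_rip n : rip (step n) (T (Y n)) = (3^-1) ^+ n * t n.
  rewrite /step ripZl // -nrm2E -nrm_sqr // -/(t n).
  by field; rewrite gt_eqF.
(* If adding the step leaves the product below [3^-n t n] in absolute value, then [rip x (T (Y n))]
   is negative, and subtracting the step pushes it below [- 3^-n t n]. *)
pose next n x := if `|rip (x + step n) (T (Y n))| >= (3^-1) ^+ n * t n
                 then x + step n else x - step n.
have next_nrm n x : nrm (next n x - x) = (3^-1) ^+ n.
  rewrite /next; case: ifP => _; rewrite addrAC subrr add0r ?nrmN //.
have next_rip n x : (3^-1) ^+ n * t n <= `|rip (next n x) (T (Y n))|.
  rewrite /next; case: ifPn => //; rewrite -ltNge ripDl // ripBl // step_rip.
  set a := rip x _; set b := _ * t n; have b0 : 0 <= b.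
    by apply: mulr_ge0; [rewrite exprn_ge0 // invr_ge0 | exact: ltW].
  rewrite ltr_norml => /andP[h1 h2].
  by rewrite ler0_norm; lra.
pose X := fix X n := if n is m.+1 then next m (X m) else 0.
have X_dist n k : nrm (X (n + k)%N - X n) <= 3 / 2 * ((3^-1) ^+ n - (3^-1) ^+ (n + k)).
  elim: k => [|k IH]; first by rewrite addn0 !subrr nrm0 // mulr0.
  rewrite addnS /=; have := nrmB_trans hV (X (n + k)%N) (next (n + k)%N (X (n + k)%N)) (X n).
  by rewrite next_nrm exprS; lra.
have X_dist_le n m : (n <= m)%N -> nrm (X m - X n) <= 3 / 2 * (3^-1) ^+ n.
  move=> /subnKC <-; apply: le_trans (X_dist _ _) _.
  have : 0 <= (3^-1 : R) ^+ (n + (m - n)) by rewrite exprn_ge0 // invr_ge0.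
  by lra.
have geo (e : R) : 0 < e -> exists N, (3^-1) ^+ N < e.
  move=> e0; have : `|3^-1 : R| < 1 by rewrite ger0_norm ?invr_ge0 // invf_lt1 // ltr1n.
  move=> /cvg_expr/cvgrPdist_lt/(_ e e0)[N _ /(_ N (leqnn _))] /=.
  rewrite sub0r normrN ger0_norm ?exprn_ge0 ?invr_ge0 // => h.
  by exists N.
have [x hx] : exists x, seq_conv ip X x.
  apply: cauchy_conv; apply/(seq_cauchyP hV) => e e0.
  have e3 : 0 < e / 3 by rewrite divr_gt0.
  have [N hN] := geo _ e3; exists N => m n hm hn.
  have := nrmB_trans hV (X N) (X m) (X n); have := X_dist_le _ _ hm.
  by have := X_dist_le _ _ hn; rewrite (nrmBC hV (X N)); lra.
have bound n : n%:R <= nrm (T x).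
  (* All later steps together have at most half the length of step [n], so at least half of the
     product secured at step [n] survives in the limit. *)
  have hd : nrm (x - X n.+1) <= 3 / 2 * (3^-1) ^+ n.+1.
    by apply: (conv_nrm_le hx); exists n.+1 => m; apply: X_dist_le.
  have hr := next_rip n (X n); rewrite -[next n (X n)]/(X n.+1) in hr.
  have h1 : rip (X n.+1) (T (Y n)) = rip (T x) (Y n) - rip (x - X n.+1) (T (Y n)).
    by rewrite ripBl // hT; ring.
  have h2 := cauchy_schwarz hV (T x) (Y n).
  have h3 := cauchy_schwarz hV (x - X n.+1) (T (Y n)).
  have h4 := ler_normB (rip (T x) (Y n)) (rip (x - X n.+1) (T (Y n))).
  rewrite -h1 in h4; rewrite -/(t n) in h3.
  have h5 : nrm (x - X n.+1) * t n <= 3 / 2 * (3^-1) ^+ n.+1 * t n.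
    by rewrite ler_pM2r.
  have h6 : (3^-1) ^+ n * t n <= 2 * (nrm (T x) * nrm (Y n)).
    by rewrite exprS in h5; lra.
  have h7 : t n <= 2 * 3 ^+ n * (nrm (T x) * nrm (Y n)).
    have -> : t n = 3 ^+ n * ((3^-1) ^+ n * t n).
      by rewrite mulrA -exprMn mulfV ?expr1n ?mul1r // pnatr_eq0.
    by rewrite [2 * 3 ^+ n]mulrC -mulrA ler_pM2l // exprn_gt0.
  have := lt_le_trans (hY n) h7.
  have y0 : 0 < nrm (Y n).
    rewrite lt_neqAle nrm_ge0 andbT eq_sym; apply/eqP => y0; have := t0 n.
    by rewrite /t; move: h7; rewrite y0 !mulr0 /t; lra.
  have p3 : 0 < 2 * (3 : R) ^+ n * nrm (Y n) by rewrite !mulr_gt0 ?exprn_gt0.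
  move=> h; apply/ltW; rewrite -(ltr_pM2r p3).
  rewrite (_ : n%:R * _ = n%:R * (2 * 3 ^+ n) * nrm (Y n)); last by ring.
  by apply: lt_le_trans h _; rewrite le_eqVlt; apply/orP; left; apply/eqP; ring.
have := bound (Num.truncn (nrm (T x))).+1.
by rewrite leNgt truncnS_gt.
Qed.

End Limits.

(** * Linear maps *)

Definition lin {R : realType} {V W : lmodType R[i]} (T : V -> W) : Prop :=
  forall (a : R[i]) x y, T (a *: x + y) = a *: T x + T y.

Section LinearMaps.
Variables (R : realType) (V W : lmodType R[i]) (T : V -> W).
Hypothesis hT : lin T.

Lemma lin0 : T 0 = 0.
Proof.
have := hT (-1) 0 0; rewrite scaler0 add0r => ->.
by rewrite scaleN1r addNr.
Qed.

Lemma linZ a x : T (a *: x) = a *: T x.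
Proof. by have := hT a x 0; rewrite lin0 !addr0. Qed.

Lemma linD x y : T (x + y) = T x + T y.
Proof. by have := hT 1 x y; rewrite !scale1r. Qed.

Lemma linN x : T (- x) = - T x.
Proof. by rewrite -scaleN1r linZ scaleN1r. Qed.

Lemma linB x y : T (x - y) = T x - T y.
Proof. by rewrite linD linN. Qed.

End LinearMaps.

(** * Ranges and square roots of symmetric operators *)

Section Operators.
Variables (R : realType) (V : lmodType R[i]) (ip : V -> V -> R[i]).
Hypothesis hV : is_hilbert ip.
Local Notation nrm := (nrm ip).
Local Notation rip := (rip ip).

Lemma symmetric_ip (T : V -> V) : lin T ->
  (forall x y, rip (T x) y = rip x (T y)) -> forall x y, ip (T x) y = ip x (T y).
Proof.
by move=> Tl h x y; rewrite (ipE hV) (ipE hV x) !h (linZ Tl).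
Qed.

(** If [p] projects [x] onto the closed range, then q = x - p is orthogonal to T (T q), so T q = 0
    by symmetry. When [x] is orthogonal to the kernel, q is orthogonal to both [x] and [p], hence
    zero. *)
Lemma closure_range (T : V -> V) (S : V -> Prop) x : lin T ->
  (forall x y, ip (T x) y = ip x (T y)) -> (forall s, S s <-> exists h, s = T h) ->
  closure_set ip S x <-> forall y, T y = 0 -> ip x y = 0.
Proof.
move=> Tl Ts hS; split=> [hx y Ty|hx].
  by apply: (closure_ip0 hV) hx => s /hS[h ->]; rewrite Ts Ty ip0r.
have cl : closed_subspace ip (closure_set ip S).
  apply: closure_closed => //; first by apply/hS; exists 0; rewrite lin0.
  by move=> a s t /hS[h ->] /hS[k ->]; apply/hS; exists (a *: h + k); rewrite Tl.
have [p hp orth] := projection hV x cl.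
have Tq : T (x - p) = 0.
  apply: (nrm2_eq0 hV); rewrite nrm2E /rip Ts orth //.
  apply/(closure_seqP hV); exists (fun=> T (T (x - p))); last exact: conv_cst.
  by move=> _; apply/hS; exists (T (x - p)).
suff /eqP : x - p = 0 by rewrite subr_eq0 => /eqP ->.
apply: (nrm2_eq0 hV); rewrite nrm2E /rip ipBl // hx //.
rewrite (_ : ip p (x - p) = 0) ?subrr //.
by rewrite (ipC hV) orth // rmorph0.
Qed.

Section SquareRoot.
Variable B : V -> V.
Hypotheses (Bl : lin B) (Bs : forall x y, rip (B x) y = rip x (B y)).
Hypothesis Bc : forall x, nrm (B x) <= nrm x.

(* [sqrt_iter n] converges to [1 - sqrt (1 - B)]; [iter1 n] is the same iteration
   for [B = 1], and its increments dominate those of [sqrt_iter] in norm. *)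
Fixpoint sqrt_iter (n : nat) (x : V) : V :=
  if n is m.+1 then (2^-1)%:C%C *: (B x + sqrt_iter m (sqrt_iter m x)) else 0.

Fixpoint iter1 (n : nat) : R := if n is m.+1 then 2^-1 * (1 + iter1 m * iter1 m) else 0.

Lemma iter1_ge0 n : 0 <= iter1 n.
Proof. by case: n => //= n; have := sqr_ge0 (iter1 n); rewrite expr2; lra. Qed.

Lemma iter1_le1 n : iter1 n <= 1.
Proof. by elim: n => [|n IH] /=; rewrite ?ler01 //; have := iter1_ge0 n; nra. Qed.

Lemma iter1_leS n : iter1 n <= iter1 n.+1.
Proof. by rewrite /=; have := sqr_ge0 (1 - iter1 n); nra. Qed.

Lemma iter1_le m n : (m <= n)%N -> iter1 m <= iter1 n.
Proof.
move=> /subnKC <-; elim: (n - m)%N => [|k IH]; rewrite ?addn0 // addnS.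
exact: le_trans IH (iter1_leS _).
Qed.

Lemma sqrt_iter_lin n : lin (sqrt_iter n).
Proof.
elim: n => [|n IH] c x y /=; first by rewrite scaler0 addr0.
rewrite Bl !IH !(scalerDr, scalerA) [c * _]mulrC -!addrA; congr (_ + _).
by rewrite addrCA.
Qed.

Lemma sqrt_iter_sym n x y : rip (sqrt_iter n x) y = rip x (sqrt_iter n y).
Proof.
elim: n x y => [|n IH] x y /=; first by rewrite rip0l // rip0r.
by rewrite ripZl // ripZr // ripDl // ripDr // Bs !IH.
Qed.

Lemma sqrt_iter_nrm n x : nrm (sqrt_iter n x) <= iter1 n * nrm x.
Proof.
elim: n x => [|n IH] x /=; first by rewrite nrm0 // mul0r.
rewrite nrmZ // ger0_norm ?invr_ge0 //.
have h1 := nrmD hV (B x) (sqrt_iter n (sqrt_iter n x)); have h2 := IH (sqrt_iter n x).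
have h3 := ler_wpM2l (iter1_ge0 n) (IH x); have := Bc x.
by rewrite -mulrA ler_pM2l ?invr_gt0 // mulrDl mul1r -mulrA; lra.
Qed.

(** Writing Z for the iterates, Z_{n+1}^2 - Z_n^2 = Z_{n+1} (Z_{n+1} - Z_n) + (Z_{n+1} - Z_n) Z_n
    holds without commutation. The numbers [iter1] obey the same identity, so the norm bound passes
    through the induction. *)
Lemma sqrt_iter_step n x :
  nrm (sqrt_iter n.+1 x - sqrt_iter n x) <= (iter1 n.+1 - iter1 n) * nrm x.
Proof.
elim: n x => [|n IH] x.
  rewrite /= addr0 subr0 mulr0 addr0 mulr1 subr0 nrmZ // ger0_norm ?invr_ge0 //.
  by rewrite ler_pM2l ?invr_gt0.
have -> : sqrt_iter n.+2 x - sqrt_iter n.+1 x =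
    (2^-1)%:C%C *: (sqrt_iter n.+1 (sqrt_iter n.+1 x - sqrt_iter n x) +
      (sqrt_iter n.+1 (sqrt_iter n x) - sqrt_iter n (sqrt_iter n x))).
  rewrite (linB (sqrt_iter_lin n.+1)) addrA subrK -[sqrt_iter n.+2 x]/((2^-1)%:C%C *: (B x + _)).
  by rewrite -[X in _ - X]/((2^-1)%:C%C *: (B x + _)) -scalerBr opprD addrACA subrr add0r.
have -> : iter1 n.+2 - iter1 n.+1 =
    2^-1 * (iter1 n.+1 * (iter1 n.+1 - iter1 n) + (iter1 n.+1 - iter1 n) * iter1 n).
  by rewrite -[iter1 n.+2]/(2^-1 * (1 + iter1 n.+1 * iter1 n.+1)) [X in _ - X]/=; field.
rewrite nrmZ // ger0_norm ?invr_ge0 // -mulrA ler_pM2l ?invr_gt0 //.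
apply: le_trans (nrmD hV _ _) _.
have h1 := sqrt_iter_nrm n.+1 (sqrt_iter n.+1 x - sqrt_iter n x); have h2 := IH (sqrt_iter n x).
have h3 := ler_wpM2l (iter1_ge0 n.+1) (IH x).
have h4 : (iter1 n.+1 - iter1 n) * nrm (sqrt_iter n x) <=
    (iter1 n.+1 - iter1 n) * (iter1 n * nrm x).
  by apply: ler_wpM2l (sqrt_iter_nrm n x); rewrite subr_ge0 iter1_leS.
move: h1 h2 h3 h4; move: (iter1 n.+1) (iter1 n) (nrm (_ _)) => b c d h1 h2 h3 h4.
rewrite mulrDl -!mulrA; lra.
Qed.

Lemma sqrt_iter_dist m n x : (m <= n)%N ->
  nrm (sqrt_iter n x - sqrt_iter m x) <= (iter1 n - iter1 m) * nrm x.
Proof.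
move=> /subnKC <-; elim: (n - m)%N => [|k IH].
  by rewrite addn0 !subrr mul0r nrm0.
rewrite addnS; apply: le_trans (nrmB_trans hV (sqrt_iter (m + k) x) _ _) _.
have := sqrt_iter_step (m + k) x; lra.
Qed.

(** The increments are dominated by those of [iter1], which converges, being nondecreasing and
    bounded by 1. *)
Lemma sqrt_iter_cauchy x : seq_cauchy ip (fun n => sqrt_iter n x).
Proof.
apply/(seq_cauchyP hV) => e e0.
have ac : cvgn iter1.
  apply: nondecreasing_is_cvgn; first by move=> m n; apply: iter1_le.
  by exists 1 => _ [n _ <-]; apply: iter1_le1.
pose d := e / 2 / (nrm x + 1); have x1 : 0 < nrm x + 1 by rewrite ltr_wpDl ?nrm_ge0.
have d0 : 0 < d by rewrite /d !divr_gt0.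
have /cvgrPdist_lt/(_ _ d0)[N _ hN] := ac.
have lim_ge n : iter1 n <= limn iter1.
  by apply: nondecreasing_cvgn_le => // i j; apply: iter1_le.
have key n : (N <= n)%N -> nrm (sqrt_iter n x - sqrt_iter N x) < e / 2.
  move=> hn; apply: le_lt_trans (sqrt_iter_dist x hn) _.
  have := hN N (leqnn _); rewrite /= ltr_norml => /andP[_ h1].
  have h2 : iter1 n - iter1 N <= d by have := lim_ge n; lra.
  apply: le_lt_trans (ler_wpM2r (nrm_ge0 ip x) h2) _.
  have -> : e / 2 = d * (nrm x + 1) by rewrite /d divfK // gt_eqF.
  by rewrite ltr_pM2l // ltrDl.
exists N => m n hm hn; have := nrmB_trans hV (sqrt_iter N x) (sqrt_iter m x) (sqrt_iter n x).
by have := key m hm; have := key n hn; rewrite (nrmBC hV (sqrt_iter N x)); lra.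
Qed.

(** The pointwise limit [Z] satisfies 2 Z = B + Z^2, which says that 1 - Z squares to 1 - B. *)
Lemma sqrt_contraction : exists S : V -> V,
  [/\ lin S, forall x y, rip (S x) y = rip x (S y) & forall x, S (S x) = x - B x].
Proof.
have /choice[Z hZ] x : exists y, seq_conv ip (fun n => sqrt_iter n x) y.
  exact: (cauchy_conv hV (sqrt_iter_cauchy x)).
have Zl : lin Z.
  move=> c x y; apply: (conv_uniq hV (hZ _)).
  under eq_fun do rewrite sqrt_iter_lin.
  exact: conv_lin.
have Zs x y : rip (Z x) y = rip x (Z y).
  apply: (cvg_unique _ (conv_rip hV (hZ x) (conv_cst hV y))) => //.
  rewrite [X in (X @ _)%classic](_ : _ = fun n => rip x (sqrt_iter n y)).
    exact: (conv_rip hV (conv_cst hV x) (hZ y)).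
  by apply/funext => n; rewrite sqrt_iter_sym.
have ZZ x : Z x + Z x = B x + Z (Z x).
  have Zn w n : nrm (sqrt_iter n w) <= nrm w.
    apply: le_trans (sqrt_iter_nrm n w) _.
    by rewrite ler_piMl ?nrm_ge0 ?iter1_le1.
  (* Convergence is only pointwise, but the iterates are contractions: the error splits into Z_n
     (Z_n x - Z x) and Z_n (Z x) - Z (Z x). *)
  have hYY : seq_conv ip (fun n => sqrt_iter n (sqrt_iter n x)) (Z (Z x)).
    apply/(seq_convP hV) => e e0; have e2 : 0 < e / 2 by rewrite divr_gt0.
    have /(seq_convP hV)/(_ _ e2)[N1 hN1] := hZ x.
    have /(seq_convP hV)/(_ _ e2)[N2 hN2] := hZ (Z x).
    exists (maxn N1 N2) => n; rewrite geq_max => /andP[/hN1 h1 /hN2 h2].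
    apply: le_lt_trans (nrmB_trans hV (sqrt_iter n (Z x)) _ _) _.
    have := Zn (sqrt_iter n x - Z x) n; rewrite (linB (sqrt_iter_lin n)); lra.
  have h1 := conv_lin hV 1 (conv_cst hV (B x)) hYY.
  have h2 := conv_lin hV (2^-1)%:C%C h1 (conv_cst hV 0).
  have h3 : seq_conv ip (fun n => sqrt_iter n.+1 x) (Z x).
    by move=> e /(hZ x)[N hN]; exists N => n hn; apply/hN/leqW.
  have /= : (2^-1)%:C%C *: (1 *: B x + Z (Z x)) + 0 = Z x.
    apply: (conv_uniq hV h2); move: h3; congr (seq_conv ip _ _).
    by apply/funext => n; rewrite /= scale1r addr0.
  rewrite addr0 scale1r => {1 2}<-; rewrite -scalerDl -rmorphD /=.
  by rewrite (_ : 2^-1 + 2^-1 = 1 :> R) ?scale1r //; field.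
exists (fun x => x - Z x); split.
- by move=> c x y; rewrite Zl scalerBr opprD addrACA.
- by move=> x y; rewrite ripBl // ripBr // Zs.
- move=> x; rewrite (linB Zl).
  have -> : B x = Z x + (Z x - Z (Z x)) by rewrite addrA ZZ addrK.
  by rewrite [in RHS]opprD addrA.
Qed.

End SquareRoot.

(** With [c] a bound of [T], the operator 1 - T / c is a contraction, so the contractive case gives
    a root of T / c, rescaled by the root of [c]. *)
Theorem sqrt_exists (T : V -> V) : lin T ->
  (forall x y, rip (T x) y = rip x (T y)) -> (forall x, 0 <= rip (T x) x) ->
  exists G : V -> V,
  [/\ lin G, forall x y, rip (G x) y = rip x (G y) & forall x, G (G x) = T x].
Proof.
move=> Tl Ts Tp; have [c c0 hc] := Hellinger_Toeplitz hV Ts.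
(* Expand positivity of [T] at x - T x / c and bound the last term, (T (T x), T x) / c^2, by the
   squared norm of T x divided by [c]. *)
have TT x : nrm2 ip (T x) <= c * rip (T x) x.
  have := Tp (x - (c^-1)%:C%C *: T x).
  rewrite (linB Tl) (linZ Tl) !(ripBl, ripBr, ripZl, ripZr) // (Ts (T x) x) -!nrm2E.
  have h2 : rip (T (T x)) (T x) <= c * nrm2 ip (T x).
    apply: le_trans (rip_le hV _ _) _.
    by rewrite -nrm_sqr // expr2 mulrA ler_wpM2r ?nrm_ge0 // hc.
  have ci : 0 < c^-1 by rewrite invr_gt0.
  have h3 : c^-1 * rip (T (T x)) (T x) <= nrm2 ip (T x) by rewrite ler_pdivrMl.
  by move=> h; rewrite -ler_pdivrMl //; have := ler_wpM2l (ltW ci) h3; lra.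
pose B x := x - (c^-1)%:C%C *: T x.
have Bl : lin B.
  move=> e x y; rewrite /B Tl scalerDr opprD addrACA scalerBr.
  by rewrite !scalerA [e * _]mulrC.
have Bs x y : rip (B x) y = rip x (B y).
  by rewrite ripBl // ripBr // ripZl // ripZr // Ts.
(* By [TT] the quadratic term of the expansion is at most half of the cross term it competes
   with. *)
have Bc x : nrm (B x) <= nrm x.
  apply: nrm2_le_sqr; rewrite ?nrm_ge0 // nrm_sqr // nrm2B // nrm2Z //= ripZr //.
  have ci : 0 < c^-1 by rewrite invr_gt0.
  have h : c^-1 ^+ 2 * nrm2 ip (T x) <= c^-1 * rip (T x) x.
    by rewrite expr2 -mulrA ler_pM2l // ler_pdivrMl // TT.
  have := mulr_ge0 (ltW ci) (Tp x).
  by move: h; rewrite (ripC hV x) expr0n addr0; lra.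
have [S [Sl Ss SS]] := sqrt_contraction Bl Bs Bc.
exists (fun x => (Num.sqrt c)%:C%C *: S x); split.
- by move=> e x y; rewrite Sl scalerDr !scalerA [e * _]mulrC.
- by move=> x y; rewrite ripZl // ripZr // Ss.
- move=> x; rewrite (linZ Sl) scalerA SS /B subKr scalerA -!rmorphM /=.
  by rewrite -expr2 sqr_sqrtr ?ltW // mulfV ?gt_eqF // scale1r.
Qed.

End Operators.

(** * Extension of an isometry between ranges to a partial isometry *)

Definition ran {X Y : Type} (T : X -> Y) (y : Y) : Prop := exists x, y = T x.

Section LimitPairs.
Variables (R : realType) (X K H : lmodType R[i]).
Variables (ipK : K -> K -> R[i]) (ipH : H -> H -> R[i]) (g : X -> K) (G : X -> H).
Hypotheses (hK : is_hilbert ipK) (hH : is_hilbert ipH) (gl : lin g) (Gl : lin G).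
Hypothesis gG : forall x y, ipK (g x) (g y) = ipH (G x) (G y).

(* The closure of the graph of the isometry [g h |-> G h]. *)
Definition limit_pair (a : K) (b : H) : Prop := exists h : nat -> X,
  seq_conv ipK (fun n => g (h n)) a /\ seq_conv ipH (fun n => G (h n)) b.

Lemma limit_pair_lin c a b a' b' :
  limit_pair a b -> limit_pair a' b' -> limit_pair (c *: a + a') (c *: b + b').
Proof.
move=> [h [h1 h2]] [k [k1 k2]]; exists (fun n => c *: h n + k n).
by split; [under eq_fun do rewrite gl | under eq_fun do rewrite Gl];
  apply: conv_lin.
Qed.

Lemma limit_pair0 : limit_pair 0 0.
Proof.
exists (fun=> 0); rewrite (lin0 gl) (lin0 Gl).
by split; apply: conv_cst.
Qed.

Lemma limit_pair_ip a b a' b' :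
  limit_pair a b -> limit_pair a' b' -> ipK a a' = ipH b b'.
Proof.
have key c d c' d' : limit_pair c d -> limit_pair c' d' -> rip ipK c c' = rip ipH d d'.
  move=> [h [h1 h2]] [k [k1 k2]].
  apply: (cvg_unique _ (conv_rip hK h1 k1)) => //.
  rewrite [X in (X @ _)%classic](_ : _ = fun n => rip ipH (G (h n)) (G (k n))).
    exact: (conv_rip hH h2 k2).
  by apply/funext => n; rewrite /rip gG.
move=> h k; rewrite (ipE hK) (ipE hH) (key _ _ _ _ h k); congr Complex.
apply: key h _; rewrite -[_ *: a']addr0 -[_ *: b']addr0.
exact: limit_pair_lin k limit_pair0.
Qed.

Lemma limit_pair_closure a b : limit_pair a b -> closure_set ipH (ran G) b.
Proof.
move=> [h [_ h2]]; apply/(closure_seqP hH); exists (fun n => G (h n)) => // n.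
by exists (h n).
Qed.

(** The isometry carries Cauchy sequences to Cauchy sequences, and the target is complete. *)
Lemma limit_pair_total a : closure_set ipK (ran g) a -> exists b, limit_pair a b.
Proof.
move=> /(closure_seqP hK)[u hu hua]; have /choice[h hh] := hu.
have [b hb] : exists b, seq_conv ipH (fun n => G (h n)) b.
  apply: (cauchy_conv hH) => e /(conv_cauchy hK hua)[N hN]; exists N => m n hm hn.
  rewrite -(linB Gl) /nrm2 -gG -/(nrm2 ipK _) (linB gl) -!hh.
  exact: hN.
exists b, h; split => //; move: hua; congr (seq_conv ipK _ _).
by apply/funext.
Qed.

End LimitPairs.

Section IsometricExtension.
Variables (R : realType) (X K H : lmodType R[i]).
Variables (ipK : K -> K -> R[i]) (ipH : H -> H -> R[i]) (g : X -> K) (G : X -> H).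
Hypotheses (hK : is_hilbert ipK) (hH : is_hilbert ipH) (gl : lin g) (Gl : lin G).
Hypothesis gG : forall x y, ipK (g x) (g y) = ipH (G x) (G y).

Lemma ran_lin (Y Z : lmodType R[i]) (T : Y -> Z) : lin T ->
  forall (a : R[i]) x y, ran T x -> ran T y -> ran T (a *: x + y).
Proof. by move=> Tl a x y [h ->] [k ->]; exists (a *: h + k); rewrite Tl. Qed.

(** [J] projects onto the closed range of [g] and then follows the extended isometry. Its graph [P]
    is a linear relation with trivial multivalued part, which gives both uniqueness of values and
    linearity. *)
Theorem partial_isometry : exists J : K -> H,
  [/\ lin J, forall x, closure_set ipH (ran G) (J x),
      forall x y, closure_set ipK (ran g) x -> ipH (J x) (J y) = ipK x y,
      forall b, closure_set ipH (ran G) b ->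
        exists2 a, closure_set ipK (ran g) a & J a = b
    & forall h, J (g h) = G h].
Proof.
set N := closure_set ipK (ran g).
have Ncl : closed_subspace ipK N.
  by apply: closure_closed => //; [exists 0; rewrite lin0 | apply: ran_lin].
have [N0 Nl _] := Ncl.
pose P x b := exists a, [/\ N a, forall s, N s -> ipK (x - a) s = 0
  & limit_pair ipK ipH g G a b].
have Pl c x y b d : P x b -> P y d -> P (c *: x + y) (c *: b + d).
  move=> [a [a1 a2 a3]] [a' [a1' a2' a3']]; exists (c *: a + a'); split.
  - exact: Nl.
  - move=> s hs; rewrite opprD addrACA -scalerBr ipPl // a2 // a2' //.
    by rewrite mulr0 addr0.
  - exact: limit_pair_lin.
have P0 b : P 0 b -> b = 0.
  move=> [a [a1 a2 a3]]; have := a2 a a1; rewrite sub0r ipNl // => /eqP.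
  rewrite oppr_eq0 (limit_pair_ip hK hH gl Gl gG a3 a3) => /eqP h.
  by apply: (nrm2_eq0 hH); rewrite /nrm2 h.
have /choice[J hJ] x : exists b, P x b.
  have [a Na orth] := projection hK x Ncl.
  by have [b hb] := limit_pair_total hK hH gl Gl gG Na; exists b, a.
have Puniq x b : P x b -> J x = b.
  move=> hb; have := Pl (-1) _ _ _ _ hb (hJ x); rewrite !scaleN1r addNr => /P0 h.
  by apply/eqP; rewrite -subr_eq0 addrC h.
have PN a b : N a -> limit_pair ipK ipH g G a b -> P a b.
  by move=> Na ab; exists a; split => // s _; rewrite subrr ip0l.
exists J; split.
- by move=> c x y; apply: Puniq; apply: Pl.
- by move=> x; have [a [_ _ /limit_pair_closure]] := hJ x; apply.
- move=> x y Nx; have [a [Na orth ay]] := hJ y.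
  have [b xb] := limit_pair_total hK hH gl Gl gG Nx.
  rewrite (Puniq _ _ (PN _ _ Nx xb)) -(limit_pair_ip hK hH gl Gl gG xb ay).
  rewrite -[y in RHS](subrK a) ipDr // [ipK x (y - a)](ipC hK) orth //.
  by rewrite rmorph0 add0r.
(* The hypotheses are symmetric in [g] and [G], so totality with the roles exchanged yields
   preimages. *)
- move=> b Hb; have Gg x y : ipH (G x) (G y) = ipK (g x) (g y) by rewrite gG.
  have [a ba] := limit_pair_total hH hK Gl gl Gg Hb.
  exists a; first exact: limit_pair_closure ba.
  apply/Puniq/PN; first exact: limit_pair_closure ba.
  by have [h [h1 h2]] := ba; exists h.
- move=> h; apply/Puniq/PN.
    by apply/(closure_seqP hK); exists (fun=> g h); [exists h | apply: conv_cst].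
  by exists (fun=> h); split; apply: conv_cst.
Qed.

End IsometricExtension.

(** * Adjoint relations *)

Section Adjoint.
Variables (R : realType) (K : lmodType R[i]) (ip : K -> K -> R[i]).
Hypothesis hK : is_hilbert ip.
Variable A : K -> K -> Prop.

Lemma adj_lin a f f' g g' : adj_rel ip A f f' -> adj_rel ip A g g' ->
  adj_rel ip A (a *: f + g) (a *: f' + g').
Proof.
move=> hf hg k k' hk.
by rewrite !ipDr // !ipZr // (hf _ _ hk) (hg _ _ hk).
Qed.

Lemma adj_closed u v f f' : (forall n, adj_rel ip A (u n) (v n)) ->
  seq_conv ip u f -> seq_conv ip v f' -> adj_rel ip A f f'.
Proof.
move=> huv hu hv g g' hg.
have key k k' h h' : seq_conv ip k h -> seq_conv ip k' h' ->
    (forall n, adj_rel ip A (k n) (k' n)) -> rip ip g' h = rip ip g h'.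
  move=> ch ch' hk; apply: (cvg_unique _ (conv_rip hK (conv_cst hK g') ch)) => //.
  rewrite [X in (X @ _)%classic](_ : _ = fun n => rip ip g (k' n)).
    exact: (conv_rip hK (conv_cst hK g) ch').
  by apply/funext => n; rewrite /rip (hk n _ _ hg).
have cZ w x : seq_conv ip w x -> seq_conv ip (fun n => iC *: w n) (iC *: x).
  move=> hw; have := conv_lin hK iC hw (conv_cst hK 0); rewrite addr0.
  by under eq_fun do rewrite addr0.
rewrite (ipE hK) (ipE hK g) (key _ _ _ _ hu hv huv); congr Complex.
apply: (key _ _ _ _ (cZ _ _ hu) (cZ _ _ hv)) => n k k' hk.
by rewrite !ipZr // (huv n _ _ hk).
Qed.

End Adjoint.

Lemma subrBB (V : zmodType) (a b c d : V) : (a - b) - (c - d) = (a - c) - (b - d).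
Proof. by rewrite !opprB addrACA [RHS]addrACA [- b - c]addrC. Qed.

(** * Selfadjoint relations at nonreal points *)

Section Resolvent.
Variables (R : realType) (K : lmodType R[i]) (ip : K -> K -> R[i]).
Hypothesis hK : is_hilbert ip.
Variable A0 : K -> K -> Prop.
Hypothesis sa : selfadjoint_rel ip A0.
Local Notation nrm := (nrm ip).

Lemma sa_ip f f' g g' : A0 f f' -> A0 g g' -> ip f' g = ip f g'.
Proof. by move=> hf /sa; apply. Qed.

Lemma sa_lin a f f' g g' : A0 f f' -> A0 g g' -> A0 (a *: f + g) (a *: f' + g').
Proof.
move=> hf hg; apply/sa => k k' hk.
by rewrite !ipDr // !ipZr // (sa_ip hk hf) (sa_ip hk hg).
Qed.

Lemma sa0 : A0 0 0.
Proof. by apply/sa => k k' _; rewrite !ip0r. Qed.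

(** Since (f', f) is real, the imaginary part of (f' - l f, f) is - Im l times the squared norm of
    [f]; Cauchy-Schwarz bounds it. *)
Lemma sa_bound l f f' : A0 f f' -> `|complex.Im l| * nrm f <= nrm (f' - l *: f).
Proof.
move=> h; have [f0|f0] := eqVneq (nrm f) 0; first by rewrite f0 mulr0 nrm_ge0.
have pf : 0 < nrm f by rewrite lt_neqAle eq_sym f0 nrm_ge0.
rewrite -(ler_pM2r pf) -mulrA -expr2 nrm_sqr //.
have im (x : K) : complex.Im (ip x x) = 0.
  by have := ipC hK x x; case: (ip x x) => p q [] /=; lra.
have e : complex.Im (ip (f' - l *: f) f) = - (complex.Im l * nrm2 ip f).
  rewrite ipBl // ipZl // /nrm2.
  have := im f; have := ipC hK f f'; rewrite -(sa_ip h h).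
  by case: (ip f' f) (ip f f) l => p q [s t] [v w] /= [] hq ->; lra.
have : complex.Im (ip (f' - l *: f) f) = rip ip (f' - l *: f) (iC *: f).
  by rewrite [in LHS](ipE hK).
rewrite e => h1.
have := cauchy_schwarz hK (f' - l *: f) (iC *: f).
by rewrite -h1 normrN normrM (ger0_norm (nrm2_ge0 hK f)) nrm_iC.
Qed.

Lemma sa_closed : closed_rel ip A0.
Proof.
move=> u v f f' huv hu hv; apply/sa.
by apply: (adj_closed hK _ hu hv) => n; apply/sa.
Qed.

(** The range of A0 - l is closed by [sa_bound]. A vector q orthogonal to it satisfies {q, l^* q} in
    A0 by selfadjointness, and [sa_bound] at the conjugate point gives q = 0. *)
Theorem sa_surjective l z : nonreal l -> exists f f', A0 f f' /\ f' - l *: f = z.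
Proof.
move=> hl; have l0 : 0 < `|complex.Im l| by rewrite normr_gt0.
pose S x := exists f f', A0 f f' /\ f' - l *: f = x.
have Scl : closed_subspace ip S.
  split.
  - by exists 0, 0; split; [exact: sa0 | rewrite scaler0 subr0].
  - move=> a x y [f [f' [hf <-]]] [g [g' [hg <-]]].
    exists (a *: f + g), (a *: f' + g'); split; first exact: sa_lin.
    rewrite scalerDr scalerBr opprD addrACA; congr (_ - _ + _).
    by rewrite !scalerA mulrC.
  - move=> u x hu cu; have /choice[f hf] := hu; have /choice[f' hff] := hf.
    have [y hy] : exists y, seq_conv ip f y.
      apply: (cauchy_conv hK); apply/(seq_cauchyP hK) => e e0.
      have /(_ _ (mulr_gt0 l0 e0))[N hN] := (seq_cauchyP hK u).1 (conv_cauchy hK cu).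
      exists N => m n hm hn; rewrite -(ltr_pM2l l0).
      have hd := sa_lin (-1) (hff n).1 (hff m).1.
      rewrite !scaleN1r ![- _ + _]addrC in hd.
      apply: le_lt_trans (sa_bound l hd) _.
      apply: le_lt_trans (hN m n hm hn).
      by rewrite -(hff m).2 -(hff n).2 scalerBr subrBB.
    exists y, (l *: y + x); split; last by rewrite addrC addrA addNr add0r.
    apply: (sa_closed (fun n => (hff n).1) hy).
    have := conv_lin hK l hy cu; congr (seq_conv ip _ _).
    by apply/funext => n; rewrite -(hff n).2 addrC subrK.
have [p [f [f' [hf hp]]] orth] := projection hK z Scl.
exists f, f'; split => //; rewrite hp; apply/eqP; rewrite eq_sym -subr_eq0; apply/eqP.
set q := z - p in orth *.
have hq : A0 q (l^* *: q).
  apply/sa => g g' hg; have : ip (g' - l *: g) q = 0.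
    by rewrite (ipC hK) orth ?rmorph0 //; exists g, g'.
  rewrite ipBl // ipZl // ipZr // => /eqP; rewrite subr_eq0 => /eqP ->.
  by rewrite conjCK.
have := sa_bound (l^*) hq; rewrite subrr nrm0 // => h.
apply: (nrm_eq0 hK); apply/eqP; rewrite eq_le nrm_ge0 andbT.
have l0' : 0 < `|complex.Im l^*|.
  by move: l0; case: (l) => a b /=; rewrite normrN.
by rewrite -(ler_pM2l l0') mulr0.
Qed.

End Resolvent.

Lemma conj_iC (R : realType) : (iC : R[i])^* = - iC.
Proof. by apply/eqP; rewrite eq_complex /= oppr0 !eqxx. Qed.

Lemma iC_neq0 (R : realType) : (iC : R[i]) != 0.
Proof. by rewrite eq_complex /= oner_eq0 andbF. Qed.

Lemma nonreal_iC (R : realType) : nonreal (iC : R[i]).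
Proof. exact: oner_neq0. Qed.

Lemma nonreal_conj (R : realType) (l : R[i]) : nonreal l -> nonreal l^*.
Proof. by rewrite /nonreal; case: l => a b /=; rewrite oppr_eq0. Qed.

Lemma sub_conj (R : realType) (l : R[i]) : (2 * iC)^-1 * (l - l^*) = (complex.Im l)%:C%C.
Proof.
have -> : l - l^* = 2 * iC * (complex.Im l)%:C%C.
  rewrite -mulrA mulr_natl mulr2n; case: l => a b; apply/eqP.
  by rewrite eq_complex /=; apply/andP; split; apply/eqP; ring.
by rewrite mulKf // mulf_neq0 ?iC_neq0 // pnatr_eq0.
Qed.

Lemma ip_ext (R : realType) (V : lmodType R[i]) (ip : V -> V -> R[i]) (x y : V) :
  is_hilbert ip -> (forall z, ip x z = ip y z) -> x = y.
Proof. by move=> hV h; apply: (rip_ext hV) => z; rewrite /rip h. Qed.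

(** * The gamma field, the Weyl function and the space H_s *)

Section WeylFunction.
Variables (R : realType) (K H : lmodType R[i]).
Variables (ipK : K -> K -> R[i]) (ipH : H -> H -> R[i]).
Variables (A : K -> K -> Prop) (Gam : K -> K -> H -> H -> Prop).
Hypotheses (hK : is_hilbert ipK) (hH : is_hilbert ipH).
Hypothesis hG : B_gen_boundary_pair ipK ipH A Gam.
Local Notation A0 := (ker_Gam0 Gam).

Lemma Gam_lin a f f' h h' g g' k k' : Gam f f' h h' -> Gam g g' k k' ->
  Gam (a *: f + g) (a *: f' + g') (a *: h + k) (a *: h' + k').
Proof. by case: hG => [[_ h1 _]]; apply: h1. Qed.

Lemma Gam_add f f' h h' g g' k k' : Gam f f' h h' -> Gam g g' k k' ->
  Gam (f + g) (f' + g') (h + k) (h' + k').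
Proof. by move=> h1 h2; have := Gam_lin 1 h1 h2; rewrite !scale1r. Qed.

Lemma Gam_sub f f' h h' g g' k k' : Gam f f' h h' -> Gam g g' k k' ->
  Gam (f - g) (f' - g') (h - k) (h' - k').
Proof.
move=> h1 h2; have := Gam_lin (-1) h2 h1; rewrite !scaleN1r.
by rewrite ![- _ + _]addrC.
Qed.

Lemma dom_adj f f' h h' : Gam f f' h h' -> adj_rel ipK A f f'.
Proof. by case: hG => [_ [h1 _ _ _ _]]; apply: h1. Qed.

Lemma green f f' h h' g g' k k' : Gam f f' h h' -> Gam g g' k k' ->
  ipK f' g - ipK f g' = ipH h' k - ipH h k'.
Proof. by case: hG => [_ [_ _ h1 _ _]]; apply: h1. Qed.

Lemma Gam0_surj h : exists f f' h', Gam f f' h h'.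
Proof. by case: hG => [_ [_ _ _ h1 _]]; apply: h1. Qed.

Lemma A0_sa : selfadjoint_rel ipK A0.
Proof. by case: hG => [_ []]. Qed.

(** Green's identity makes [h] orthogonal to every value of Gamma_0, that is, to the whole space. *)
Lemma Gam_mul h : Gam 0 0 0 h -> h = 0.
Proof.
move=> h0; apply: (ip_ext hH) => k; have [g [g' [k' hk]]] := Gam0_surj k.
by have := green h0 hk; rewrite !(ip0l hK) !(ip0l hH) !subr0 => <-.
Qed.

Lemma A0_eigen l f : nonreal l -> A0 f (l *: f) -> f = 0.
Proof.
move=> hl h; have := sa_bound hK A0_sa l h; rewrite subrr nrm0 // => h1.
apply: (nrm_eq0 hK); apply/eqP; rewrite eq_le nrm_ge0 andbT.
by rewrite -(@ler_pM2l _ `|complex.Im l|) ?normr_gt0 // mulr0.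
Qed.

Lemma weyl_uniq l f g h h1 h2 : nonreal l ->
  Gam f (l *: f) h h1 -> Gam g (l *: g) h h2 -> f = g /\ h1 = h2.
Proof.
move=> hl hf hg; have := Gam_sub hf hg; rewrite subrr -scalerBr => h0.
have fg : f - g = 0 by apply: (A0_eigen hl); exists (h1 - h2).
move: h0; rewrite fg scaler0 => /Gam_mul h12.
by split; apply/eqP; rewrite -subr_eq0 ?fg ?h12.
Qed.

(** Take any element of Gamma with Gamma_0-value [h] and subtract an element of A0 with the same f'
    - l f; the value [h] is unchanged. *)
Lemma weyl_surj l h : nonreal l -> exists f h', Gam f (l *: f) h h'.
Proof.
move=> hl; have [f [f' [h' hf]]] := Gam0_surj h.
have [g [g' [[k hg] e]]] := sa_surjective hK A0_sa (f' - l *: f) hl.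
have := Gam_sub hf hg; rewrite subr0.
rewrite (_ : f' - g' = l *: (f - g)) => [hfg|]; first by exists (f - g), (h' - k).
by apply/eqP; rewrite scalerBr -subr_eq0 subrBB -e subrr.
Qed.

Lemma gamma_weyl l : nonreal l -> exists (gam : H -> K) (M : H -> H),
  [/\ lin gam, lin M
    & forall f h h', Gam f (l *: f) h h' <-> f = gam h /\ h' = M h].
Proof.
move=> hl; have /choice[gam hgam] h := weyl_surj h hl.
have /choice[M hM] := hgam.
have P f h h' : Gam f (l *: f) h h' <-> f = gam h /\ h' = M h.
  by split=> [/(weyl_uniq hl)/(_ (hM h))|[-> ->]].
have L a x y : gam (a *: x + y) = a *: gam x + gam y /\ M (a *: x + y) = a *: M x + M y.
  have := Gam_lin a (hM x) (hM y); rewrite scalerA mulrC -scalerA -scalerDr.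
  by move=> /P[-> ->].
by exists gam, M; split=> // a x y; case: (L a x y).
Qed.

(** Expresses that the Weyl function at the conjugate point is the adjoint of the one at [l]. *)
Lemma weyl_conj l f h h' g k k' :
  Gam f (l *: f) h h' -> Gam g (l^* *: g) k k' -> ipH h' k = ipH h k'.
Proof.
move=> hf hg; have := green hf hg; rewrite ipZl // ipZr // conjCK subrr.
by move/esym/eqP; rewrite subr_eq0 => /eqP.
Qed.

Lemma weyl_im l f h h' g k k' f2 h2 :
  Gam f (l *: f) h h' -> Gam g (l *: g) k k' -> Gam f2 (l^* *: f2) h h2 ->
  ipH ((2 * iC)^-1 *: (h' - h2)) k = (complex.Im l)%:C%C * ipK f g.
Proof.
move=> hf hg hf2; rewrite ipZl // ipBl // -sub_conj -mulrA; congr (_ * _).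
have := green hf hg; rewrite ipZl // ipZr // -mulrBl => ->; congr (_ - _).
by rewrite (ipC hH k) -(weyl_conj hg hf2) -(ipC hH).
Qed.

Lemma ran_ImP l gam M gam2 M2 x :
  (forall f h h', Gam f (l *: f) h h' <-> f = gam h /\ h' = M h) ->
  (forall f h h', Gam f (l^* *: f) h h' <-> f = gam2 h /\ h' = M2 h) ->
  ran_Im_rel ipH (weyl_family Gam l) x <->
  exists h, x = (2 * iC)^-1 *: (M h - M2 h).
Proof.
move=> hM hM2; have hc h k : ipH (M k) h = ipH k (M2 h).
  by apply: (@weyl_conj l (gam k) k _ (gam2 h)); [apply/hM | apply/hM2].
split=> [[h [h1 [h2 [[f /hM[_ ->]] [adj ->]]]]]|[h ->]].
  exists h; congr (_ *: (_ - _)); apply: (ip_ext hH) => k.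
  rewrite (ipC hH k) (ipC hH k (M2 h)) -hc -(adj k (M k)) //.
  by exists (gam k); apply/hM.
exists h, (M h), (M2 h); split; first by exists (gam h); apply/hM.
by split=> // k k' [f /hM[_ ->]].
Qed.

(** The right-hand side does not mention [l], which yields the independence of H_s from the spectral
    point. *)
Lemma Hs_ofP l x : nonreal l -> Hs_of ipH Gam l x <->
  forall y, (exists h', Gam 0 0 y h') -> ipH x y = 0.
Proof.
move=> hl; have [gam [M [gaml Ml hM]]] := gamma_weyl hl.
have [gam2 [M2 [_ M2l hM2]]] := gamma_weyl (nonreal_conj hl).
pose T h := (2 * iC)^-1 *: (M h - M2 h).
have im h k : ipH (T h) k = (complex.Im l)%:C%C * ipK (gam h) (gam k).
  by apply: (@weyl_im l _ h _ _ k (M k) (gam2 h)); first [apply/hM | apply/hM2].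
have Tl : lin T.
  by move=> a h k; rewrite /T Ml M2l opprD addrACA -scalerBr scalerDr !scalerA mulrC.
have Ts h k : ipH (T h) k = ipH h (T k).
  rewrite (ipC hH (T k)) !im rmorphM /= -(ipC hK); congr (_ * _).
  by apply/eqP; rewrite eq_complex /= oppr0 !eqxx.
have ker y : T y = 0 <-> exists h', Gam 0 0 y h'.
  split=> [Ty|[h' hy]].
    exists (M y); have := im y y; rewrite Ty ip0l // => /esym/eqP.
    rewrite mulf_eq0 eq_complex /= eqxx andbT (negbTE hl) /= => /eqP g0.
    have := (hM (gam y) y (M y)).2 (conj erefl erefl).
    have [_ _ _ h0 _] := hK; rewrite (h0 _ g0).
    by rewrite scaler0.
  have [] := (hM 0 y h').1; first by rewrite scaler0.
  move=> g0 _; apply: (ip_ext hH) => k.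
  by rewrite im -g0 !ip0l // mulr0.
rewrite /Hs_of (closure_range hH x Tl Ts); last by move=> s; apply: ran_ImP.
by split=> h y /ker; apply: h.
Qed.

End WeylFunction.

(** * Construction of the ordinary boundary triple at the point i *)

Section BoundaryTriple.
Variables (R : realType) (K H : lmodType R[i]).
Variables (ipK : K -> K -> R[i]) (ipH : H -> H -> R[i]).
Variables (A : K -> K -> Prop) (Gam : K -> K -> H -> H -> Prop).
Hypotheses (hK : is_hilbert ipK) (hH : is_hilbert ipH).
Hypothesis hG : B_gen_boundary_pair ipK ipH A Gam.
Local Notation A0 := (ker_Gam0 Gam).
Local Notation sa := (A0_sa hG).

Lemma A0_adj f f' : A0 f f' -> adj_rel ipK A f f'.
Proof. by move=> [k /(dom_adj hG)]. Qed.

(** [r] is the resolvent of A0 at i, which selects the A0-component in the decomposition of the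
    adjoint. *)
Lemma resolvent : exists r : K -> K,
  [/\ lin r, forall z, A0 (r z) (iC *: r z + z)
    & forall f f', A0 f f' -> r (f' - iC *: f) = f].
Proof.
have /choice[r hr] z : exists f, A0 f (iC *: f + z).
  have [f [f' [hf <-]]] := sa_surjective hK sa z (nonreal_iC R).
  by exists f; rewrite addrC subrK.
have ru f f' : A0 f f' -> r (f' - iC *: f) = f.
  move=> hf; have := sa_lin hK sa (-1) (hr (f' - iC *: f)) hf.
  set z := r _; rewrite !scaleN1r ![- _ + _]addrC => h.
  apply/eqP; rewrite eq_sym -subr_eq0; apply/eqP.
  apply: (A0_eigen hK hG (nonreal_iC R)); move: h.
  by rewrite [iC *: z + _]addrC opprD addrA subKr -scalerBr.
exists r; split=> // a x y.
have := ru _ _ (sa_lin hK sa a (hr x) (hr y)).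
rewrite !scalerDr !scalerA [a * _]mulrC -!scalerA.
by rewrite addrACA -scalerDr addrAC subrr add0r.
Qed.

Section Gamma.
Variables (gam : H -> K) (M : H -> H).
Hypotheses (gaml : lin gam) (Ml : lin M).
Hypothesis hM : forall f h h', Gam f (iC *: f) h h' <-> f = gam h /\ h' = M h.

Lemma Gam_gamma h : Gam (gam h) (iC *: gam h) h (M h).
Proof. exact/hM. Qed.

Lemma gamma_kernel_green f0 f0' k' h : Gam f0 f0' 0 k' ->
  ipH k' h = ipK (f0' + iC *: f0) (gam h).
Proof.
move=> hf; have := green hG hf (Gam_gamma h).
by rewrite (ip0l hH) subr0 ipZr // conj_iC mulNr opprK ipDl // ipZl.
Qed.

(** For the converse, approximate {a, i a} by {g, g'} in dom Gamma and subtract {g0, g0'} in A0 with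
    g0' - i g0 = g' - i g. The rest lies in the range of [gam], and g0 is small because g' - i g
    is. *)
Lemma closure_ran_gamma a :
  closure_set ipK (ran gam) a <-> adj_rel ipK A a (iC *: a).
Proof.
split=> [/(closure_seqP hK)[u hu hua]|ha].
  apply: (adj_closed hK _ hua); last first.
    have := conv_lin hK iC hua (conv_cst hK 0); rewrite addr0; apply.
  by move=> n; have [h ->] := hu n; rewrite addr0; exact: (dom_adj hG (Gam_gamma h)).
move=> e e0.
(* With d = sqrt e / 4, the errors [x] and [y] have norm below d, and the final distance is at most
   twice the first plus the second, below 3 d. *)
have e1 : 0 < e / 16 by rewrite divr_gt0.
have [_ [_ dense _ _ _]] := hG.
have [g [g' [k [k' [hg hd]]]]] := dense _ _ ha _ e1.
have [g0 [g0' [[q hg0] e']]] := sa_surjective hK sa (g' - iC *: g) (nonreal_iC R).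
have := Gam_sub hG hg hg0; rewrite subr0.
rewrite (_ : g' - g0' = iC *: (g - g0)) => [/hM[hgam _]|]; last first.
  by apply/eqP; rewrite scalerBr -subr_eq0 subrBB -e' subrr.
exists (g - g0); split; first by exists k.
set x := a - g in hd; set y := iC *: a - g' in hd.
pose d := Num.sqrt (e / 16).
have d0 : 0 < d by rewrite sqrtr_gt0.
have dd : d ^+ 2 = e / 16 by rewrite sqr_sqrtr // ltW.
have hx : nrm ipK x < d.
  by apply: (nrm2_lt hK d0); rewrite dd; have := nrm2_ge0 hK y; lra.
have hy : nrm ipK y < d.
  by apply: (nrm2_lt hK d0); rewrite dd; have := nrm2_ge0 hK x; lra.
have b0 : nrm ipK g0 <= nrm ipK (iC *: x - y).
  have := sa_bound hK sa iC (ex_intro _ q hg0); rewrite /= normr1 mul1r e'.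
  by rewrite /x /y scalerBr subrBB subrr sub0r opprB.
have b1 : nrm ipK (a - (g - g0)) <= nrm ipK x + nrm ipK g0.
  by rewrite opprB addrCA addrC; apply: nrmD.
have b2 : nrm ipK (iC *: x - y) <= nrm ipK x + nrm ipK y.
  by apply: le_trans (nrmD hK _ _) _; rewrite nrmN // nrm_iC.
have -> : e = (4 * d) ^+ 2 by rewrite exprMn dd; field.
by apply: lt_nrm2 => //; lra.
Qed.

Lemma E_G_factorization : exists (E G : H -> H),
  [/\ lin E /\ (forall h k, ipH (E h) k = ipH h (E k)),
      lin G /\ (forall h k, ipH (G h) k = ipH h (G k)),
      forall h, M h = E h + iC *: G (G h)
    & forall h k, ipK (gam h) (gam k) = ipH (G h) (G k)].
Proof.
(* [M2] is M(-i), which acts as the adjoint of [M], so [T] and [E] are the imaginary and real parts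
   of M(i). *)
have [gam2 [M2 [_ M2l hM2]]] := gamma_weyl hK hH hG (nonreal_conj (nonreal_iC R)).
pose T h := (2 * iC)^-1 *: (M h - M2 h).
pose E h := 2^-1 *: (M h + M2 h).
have im h k : ipH (T h) k = ipK (gam h) (gam k).
  rewrite (@weyl_im _ _ _ _ _ _ _ hK hH hG iC (gam h) h _ (gam k) k (M k) (gam2 h)).
  - by rewrite (_ : real_complex R _ = 1) ?mul1r.
  - exact: Gam_gamma.
  - exact: Gam_gamma.
  - exact/hM2.
have Tl : lin T.
  by move=> a h k; rewrite /T Ml M2l opprD addrACA -scalerBr scalerDr !scalerA mulrC.
have El : lin E.
  by move=> a h k; rewrite /E Ml M2l !scalerDr !scalerA [2^-1 * a]mulrC addrACA.
have Ts h k : rip ipH (T h) k = rip ipH h (T k).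
  by rewrite [RHS](ripC hH) /rip !im; apply: (ripC hK).
have Tp h : 0 <= rip ipH (T h) h by rewrite /rip im; apply: (nrm2_ge0 hK).
have [G [Gl Gs GG]] := sqrt_exists hH Tl Ts Tp.
have {}Gs := symmetric_ip hH Gl Gs.
have MM2 h k : ipH (M h) k = ipH h (M2 k).
  exact: (weyl_conj hK hG (Gam_gamma h) ((hM2 _ _ _).2 (conj erefl erefl))).
have M2M h k : ipH (M2 h) k = ipH h (M k).
  by rewrite (ipC hH k) -MM2 -(ipC hH).
exists E, G; split=> //; first split=> // h k.
- rewrite /E ipZl // ipZr // ipDl // ipDr // MM2 M2M addrC; congr (_ * _).
  by rewrite fmorphV rmorph_nat.
- move=> h; rewrite GG /E /T scalerA invfM mulrCA mulfV ?iC_neq0 // mulr1.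
  rewrite -scalerDr addrACA subrr addr0 -[M h + M h]mulr2n -[M h *+ 2]scaler_nat.
  rewrite scalerA mulVf ?scale1r //.
  by rewrite pnatr_eq0.
- by move=> h k; rewrite -Gs GG im.
Qed.

End Gamma.

Lemma Gam0_triple : let Hs := Hs_of ipH Gam iC in
  exists (G00 G01 : K -> K -> H) (E G : H -> H),
  [/\ ordinary_boundary_triple ipK ipH A Hs G00 G01,
      bounded_linear ipH ipH E /\ (forall h k, ipH (E h) k = ipH h (E k)),
      bounded_linear ipH ipH G /\ (forall h k, ipH (G h) k = ipH h (G k)),
      (forall h, Hs (G h)) /\ (forall h, G h = 0 <-> (forall x, Hs x -> ipH h x = 0))
    & forall f f' h h', Gam f f' h h' <->
        (adj_rel ipK A f f' /\ G h = G00 f f' /\ h' = E h + G (G01 f f'))].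
Proof.
move=> Hs.
have [gam [M [gaml Ml hM]]] := gamma_weyl hK hH hG (nonreal_iC R).
have [E [G [[El Es] [Gl Gs] MEG gG]]] := E_G_factorization Ml hM.
have [r [rl rA0 rE]] := resolvent.
have [J [Jl JHs Jip Jsurj Jgam]] := partial_isometry hK hH gaml Gl gG.
set N := closure_set ipK (ran gam) in Jip Jsurj.
have NP a : N a <-> adj_rel ipK A a (iC *: a) := closure_ran_gamma hM a.
have Ngam h : N (gam h) by apply/NP/(dom_adj hG (Gam_gamma hM h)).
have N_lin a x y : N x -> N y -> N (a *: x + y).
  move=> /NP hx /NP hy; apply/NP; have := adj_lin hK a hx hy.
  by rewrite scalerDr !scalerA [a * _]mulrC.
have Jip' x y : N y -> ipH (J x) (J y) = ipK x y.
  by move=> Ny; rewrite (ipC hH) Jip // -(ipC hK).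
have bounded T : lin T -> (forall h k, ipH (T h) k = ipH h (T k)) -> bounded_linear ipH ipH T.
  move=> Tl Ts; split=> //.
  have [|c c0 hc] := Hellinger_Toeplitz (T := T) hH.
    by move=> x y; rewrite /rip Ts.
  exists (c ^+ 2) => x; rewrite -!nrm_sqr // -exprMn.
  by rewrite ler_pXn2r ?nnegrE ?nrm_ge0 ?mulr_ge0 ?nrm_ge0 // ltW.
have kerG h : G h = 0 <-> exists h', Gam 0 0 h h'.
  split=> [Gh|[h' h0]].
    exists (M h); have := Gam_gamma hM h; suff -> : gam h = 0 by rewrite scaler0.
    by apply: (nrm2_eq0 hK); rewrite /nrm2 gG Gh ip0l.
  have [] := (hM 0 h h').1; first by rewrite scaler0.
  by move=> g0 _; apply: (nrm2_eq0 hH); rewrite /nrm2 -gG -g0 ip0l.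
(* [G] has the same kernel as Im M(i), so both ranges have the same closure. *)
have HsP x : Hs x <-> closure_set ipH (ran G) x.
  rewrite (closure_range hH x Gl Gs (S := ran G)) // /Hs.
  rewrite (Hs_ofP hK hH hG x (nonreal_iC R)).
  by split=> h y /kerG; apply: h.
have HsG h : Hs (G h).
  by apply/HsP/(closure_seqP hH); exists (fun=> G h); [exists h | apply: conv_cst].
have kerGperp h : G h = 0 <-> (forall x, Hs x -> ipH h x = 0).
  split=> [Gh x /(Hs_ofP hK hH hG x (nonreal_iC R)) hx|hx].
    by rewrite (ipC hH) hx ?rmorph0 //; apply/kerG.
  by apply: (nrm2_eq0 hH); rewrite /nrm2 Gs hx.
have A0ip f f' g g' : A0 f f' -> A0 g g' -> ipK f' g = ipK f g' by apply: (sa_ip sa).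
have decomp f f' : adj_rel ipK A f f' -> exists f0 f0' a,
    [/\ A0 f0 f0', N a, f = f0 + a, f' = f0' + iC *: a & r (f' - iC *: f) = f0].
  move=> hf; set z := f' - iC *: f; pose a := f - r z.
  have f'E : f' = iC *: r z + z + iC *: a.
    rewrite /a scalerBr addrC addrA.
    by rewrite subrK /z addrC subrK.
  exists (r z), (iC *: r z + z), a; split=> //; last by rewrite addrC subrK.
  apply/NP; have := adj_lin hK (-1) (A0_adj (rA0 z)) hf.
  by rewrite !scaleN1r [- r z + f]addrC {1}f'E addKr.
have rdecomp f0 f0' a : A0 f0 f0' -> r (f0' + iC *: a - iC *: (f0 + a)) = f0.
  move=> /rE h; rewrite scalerDr opprD addrACA subrr addr0. exact: h.
have G01E f0 f0' a : f0' + iC *: a + iC *: f0 = iC *: a + (f0' + iC *: f0).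
  by rewrite addrAC addrC.
have GJ f0 f0' k' : Gam f0 f0' 0 k' -> k' = G (J (f0' + iC *: f0)).
  move=> hf; apply: (ip_ext hH) => k.
  by rewrite (gamma_kernel_green hM k hf) Gs -Jgam Jip'.
(* With [f0 = r (f' - i f)], these are [J a] and [J (i a + f0' + i f0)]. *)
pose G00 f f' := J (f - r (f' - iC *: f)).
pose G01 f f' := J (f' + iC *: r (f' - iC *: f)).
exists G00, G01, E, G; split; [|split=> //; exact: bounded|split=> //; exact: bounded|by []|].
- split.
  + move=> c f f' g g' _ _.
    have rc : r (c *: f' + g' - iC *: (c *: f + g)) = c *: r (f' - iC *: f) + r (g' - iC *: g).
      by rewrite -rl !scalerDr scalerN !scalerA [c * iC]mulrC opprD addrACA.
    rewrite /G00 /G01 rc -!Jl; split; congr J.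
      by rewrite scalerBr opprD addrACA.
    by rewrite !scalerDr !scalerA [c * iC]mulrC addrACA.
  + by move=> f f' _; split; apply/HsP/JHs.
  (* Both sides equal (f0' + i f0, b) - (a, g0' + i g0) + 2 i (a, b), the pure A0 terms cancelling
     by symmetry. *)
  + move=> f f' g g' /decomp[f0 [f0' [a [hf Na fE f'E rf]]]].
    move=> /decomp[g0 [g0' [b [hg Nb gE g'E rg]]]].
    rewrite /G00 /G01 rf rg {rf rg} fE f'E gE g'E ![_ + a - _]addrAC ![_ + b - _]addrAC.
    rewrite !subrr !add0r Jip' // Jip // !G01E.
    rewrite !(ipDl hK, ipDr hK, ipZl hK, ipZr hK) conj_iC (A0ip _ _ _ _ hf hg).
    by ring.
  + move=> x y /HsP/Jsurj[a Na <-] /HsP/Jsurj[c Nc <-].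
    have hn : nonreal (- iC : R[i]) by rewrite -conj_iC; apply/nonreal_conj/nonreal_iC.
    (* The N_i-component [a] fixes the first value; the second requires f0' + i f0 = c - i a,
       solvable in A0 at the point -i. *)
    have [f0 [f0' [hf e]]] := sa_surjective hK sa (c - iC *: a) hn.
    rewrite scaleNr opprK in e.
    exists (f0 + a), (f0' + iC *: a); split.
      have := adj_lin hK 1 (A0_adj hf) ((NP a).1 Na); by rewrite !scale1r.
    rewrite /G00 /G01 rdecomp // G01E e [iC *: a + _]addrC subrK.
    by rewrite [f0 + a]addrC addrK.
- move=> f f' h h'; split=> [hf|].
    have hadj := dom_adj hG hf; split=> //.
    have [f0 [f0' [a [[k' hf0] Na fE f'E rf]]]] := decomp _ _ hadj.
    have := Gam_sub hG hf hf0; rewrite subr0 {1}fE {1}f'E.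
    rewrite [f0 + a]addrC [f0' + _]addrC !addrK => /hM[ae h'E].
    rewrite /G00 /G01 rf {1}fE [f0 + a]addrC addrK ae Jgam; split=> //.
    rewrite f'E G01E Jl Gl -(GJ _ _ _ hf0) ae Jgam.
    by rewrite addrA -MEG -h'E subrK.
  move=> [hadj [Gh ->]]; have [f0 [f0' [a [[k' hf0] Na fE f'E rf]]]] := decomp _ _ hadj.
  move: Gh; rewrite /G00 /G01 rf {1}fE [f0 + a]addrC addrK => Gh.
  (* [J] is isometric on the defect space and takes the same value at both vectors. *)
  have ae : a = gam h.
    have Nd : N (-1 *: a + gam h) by apply: N_lin.
    apply/eqP; rewrite eq_sym -subr_eq0 addrC -scaleN1r; apply/eqP/(nrm2_eq0 hK).
    by rewrite /nrm2 -Jip // Jl scaleN1r -Gh Jgam addNr ip0l.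
  have := Gam_add hG (Gam_gamma hM h) hf0.
  rewrite addr0 -ae [a + f0]addrC [iC *: a + _]addrC -fE -f'E.
  have -> : J (f' + iC *: f0) = iC *: J a + J (f0' + iC *: f0).
    by rewrite f'E G01E Jl.
  by rewrite Gl -(GJ _ _ _ hf0) -Gh addrA -MEG.
Qed.

End BoundaryTriple.

Theorem mainTheorem6 (R : realType)
  (K : lmodType R[i]) (ipK : K -> K -> R[i])
  (H : lmodType R[i]) (ipH : H -> H -> R[i])
  (A : K -> K -> Prop) (Gam : K -> K -> H -> H -> Prop) :
  is_hilbert ipK -> is_hilbert ipH ->
  linrel A -> closed_rel ipK A -> symmetric_rel ipK A ->
  B_gen_boundary_pair ipK ipH A Gam ->
  (* calH_s = closure of ran Im M(lambda) does not depend on lambda *)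
  (forall l mu : R[i], nonreal l -> nonreal mu ->
      forall x, Hs_of ipH Gam l x <-> Hs_of ipH Gam mu x) /\
  (let Hs := Hs_of ipH Gam iC in
   exists (G00 G01 : K -> K -> H) (E G Gs : H -> H),
     ordinary_boundary_triple ipK ipH A Hs G00 G01 /\
     (* E = E^* in B(calH) *)
     bounded_linear ipH ipH E /\ (forall h k, ipH (E h) k = ipH h (E k)) /\
     (* G in B(calH, calH_s), ker G = calH (-) calH_s, Gs = G^* : calH_s -> calH *)
     bounded_linear ipH ipH G /\ (forall h, Hs (G h)) /\
     (forall h, G h = 0 <-> (forall x, Hs x -> ipH h x = 0)) /\
     (forall h x, Hs x -> ipH (G h) x = ipH h (Gs x)) /\
     (* Gamma = {{fh,{h, E h + G^* Gamma^0_1 fh}} : fh in A^*, G h = Gamma^0_0 fh} *)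
     (forall f f' h h', Gam f f' h h' <->
        (adj_rel ipK A f f' /\ G h = G00 f f' /\ h' = E h + Gs (G01 f f'))) /\
     (* M(lambda) = G^* M_0(lambda) G + E *)
     (forall l : R[i], nonreal l -> forall h h',
        weyl_family Gam l h h' <->
        (exists y, weyl_fun0 ipK A G00 G01 l (G h) y /\ h' = Gs y + E h))).
Proof.
move=> hK hH _ _ _ hG; split=> [l mu hl hmu x|Hs].
  by rewrite (Hs_ofP hK hH hG x hl) (Hs_ofP hK hH hG x hmu).
have [G00 [G01 [E [G [obt [Eb Es] [Gb Gs] [HsG kerG] GamP]]]]] := Gam0_triple hK hH hG.
(* [G] is selfadjoint with values in H_s, so G^* is [G] itself on H_s. *)
exists G00, G01, E, G, G.
do 6! [split; first by []]; split; first by move=> h x _; apply: Gs.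
(* The formula for the Weyl function is the description of Gamma restricted to pairs {f, l f}. *)
split=> // l _ h h'; split=> [[f /GamP[hf [Gh ->]]]|[y [[f [hf [Gh <-]]] ->]]].
  by exists (G01 f (l *: f)); split; [exists f | rewrite addrC].
by exists f; apply/GamP; rewrite addrC.
Qed.
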